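(* Let $M>2$ and let $x^*$ be a (non-degenerate) dual quadrilateral lattice in the Euclidean space $\mathbb{E}^M$, i.e. a map from $\mathbb{Z}^2$ to the set of affine hyperplanes of $\mathbb{E}^M$ which is a dual quadrilateral lattice. Then $x^*$ is a dual quadrilateral Bianchi lattice if and only if a field of normal vectors $\vec{n}:\mathbb{Z}^2\to\mathbb{R}^M$ ($\vec{n}(m_1,m_2)$ being a nonzero, not necessarily unit, vector normal to the hyperplane $x^*(m_1,m_2)$) can be chosen in such a way that, for some function $F^*:\mathbb{Z}^2\to\mathbb{R}$, $$\vec{n}_{(12)}+\vec{n}=F^*_{(1)}\vec{n}_{(1)}+F^*_{(2)}\vec{n}_{(2)}$$ and $$\Delta_1\Delta_2\left(\vec{n}\cdot\vec{n}\;F^*\right)=0 .$$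
   Context: Notation. For a function $f$ on $\mathbb{Z}^2$, subscripts in brackets denote shifts: $f_{(\pm1)}(m_1,m_2)=f(m_1\pm1,m_2)$, $f_{(\pm 2)}(m_1,m_2)=f(m_1,m_2\pm1)$, $f_{(12)}(m_1,m_2)=f(m_1+1,m_2+1)$, $f_{(11)}(m_1,m_2)=f(m_1+2,m_2)$, $f_{(22)}(m_1,m_2)=f(m_1,m_2+2)$, etc.; $\Delta_i f=f_{(i)}-f$. The space $\mathbb{E}^M$ is $\mathbb{R}^M$ with scalar product ''$\cdot$'', regarded as the affine part of the projective space $\mathbb{P}^M$. A hyperplane $w^*$ of $\mathbb{E}^M$ has homogeneous coordinates $(\vec\omega,\omega^{M+1})\in\mathbb{R}^{M+1}$, defined up to a nonzero factor, where $w^*=\{\vec u:\vec\omega\cdot\vec u+\omega^{M+1}=0\}$; thus $\vec\omega$ is a normal vector. A pencil of hyperplanes is the family of all hyperplanes containing a given subspace of co-dimension two (for instance the intersection of two distinct hyperplanes). Dual quadrilateral lattice. A map $x^*:\mathbb{Z}^2\to(\mathbb{P}^M)^*$ into the space of hyperplanes of $\mathbb{P}^M$, $M>2$, is a dual quadrilateral lattice if for every point of $\mathbb{Z}^2$ the intersection $x^*\cap x^*_{(1)}\cap x^*_{(2)}\cap x^*_{(12)}$ is a projective subspace of co-dimension three. Only non-degenerate lattices are considered: no three of the four neighbouring hyperplanes $x^*,x^*_{(1)},x^*_{(2)},x^*_{(12)}$ have intersection of co-dimension two. Homogeneous coordinates $\boldsymbol{x}^*:\mathbb{Z}^2\to\mathbb{R}^{M+1}\setminus\{0\}$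 of the lattice satisfy a discrete Laplace equation $\boldsymbol{x}^*_{(12)}=A^*_{(1)}\boldsymbol{x}^*_{(1)}+B^*_{(2)}\boldsymbol{x}^*_{(2)}+C^*\boldsymbol{x}^*$ with real functions $A^*,B^*,C^*$ on $\mathbb{Z}^2$. Define hyperplanes $x^*_{-1}$ and $x^*_{1}$ by homogeneous coordinates $\boldsymbol{x}^*_{-1}=\boldsymbol{x}^*_{(1)}-B^*\boldsymbol{x}^*$ and $\boldsymbol{x}^*_{1}=\boldsymbol{x}^*_{(2)}-A^*\boldsymbol{x}^*$. Dual Koenigs lattice. A dual quadrilateral lattice $x^*$ is a dual Koenigs lattice if (at each point of $\mathbb{Z}^2$) the three pencils of hyperplanes: (i) the one containing $x^*_1$ and $x^*_{-1(22)}$, (ii) the one containing $x^*_{-1}$ and $x^*_{1(11)}$, (iii) the one containing $x^*$ and $x^*_{(12)}$, have a hyperplane in common. (Here $x^*_{-1(22)}$ is the function $x^*_{-1}$ shifted twice in the second variable, and $x^*_{1(11)}$ is $x^*_1$ shifted twice in the first variable.) Dual congruence. A dual congruence is a map $L^*$ from $\mathbb{Z}^2$ to the set of co-dimension two subspaces such that any two neighbouring subspaces $L^*$ and $L^*_{(i)}$ ($i=1,2$) are contained in a common hyperplane; it is assumed non-degenerate: a subspace of the congruence has no common hyperplane with other subspaces of the congruence different from its nearest neighbours. The common hyperplanes $y^*_i$ of $L^*$ and $L^*_{(-i)}$, $i=1,2$, form its dual focal lattices; thus $y^*_i$ and $y^*_{i(i)}$ contain $L^*$. A dual quadrilateral lattice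 $x^*$ and a dual congruence $L^*$ are conjugate if $L^*\subset x^*$ at every point of $\mathbb{Z}^2$. Normal dual congruence. A dual congruence in $\mathbb{E}^M$ with dual focal lattices $y^*_1,y^*_2$ is normal if, at every point of $\mathbb{Z}^2$, the pair of orthogonal hyperplanes bisecting the angles between $y^*_2$ and $y^*_{2(2)}$ coincides with the pair of orthogonal hyperplanes bisecting the angles between $y^*_1$ and $y^*_{1(1)}$. Dual quadrilateral Bianchi lattice. A dual Koenigs lattice in $\mathbb{E}^M$ for which there exists a conjugate normal dual congruence.
   Formalization: The co-dimension three intersections of the lattice are assumed not to lie at infinity, and non-degeneracy of the dual congruence is required only locally (opposite subspaces of a quadrilateral, three consecutive ones); without these changes the ''if'' part is false. *)

(* Defs.v *)
From mathcomp Require Import all_boot all_order all_algebra reals.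

Set Implicit Arguments.
Unset Strict Implicit.
Unset Printing Implicit Defensive.

Import Order.TTheory GRing.Theory Num.Theory.
Local Open Scope ring_scope.

Notation Z2 := (int * int)%type.
Definition e1 : Z2 := (1, 0).
Definition e2 : Z2 := (0, 1).

Section Projective.
Variables (R : realType) (M : nat).

(* A projective subspace of P^M is a linear subspace of R^(M+1), with the same
   codimension; inclusion, intersection and join are those of {vspace _}. The
   last coordinate is the homogenizing one: u in E^M is the class of (u, 1). *)
Local Notation subspace := {vspace 'rV[R]_(M + 1)}.
Implicit Types (H K Q U L : subspace) (w : 'rV[R]_(M + 1)).

Definition has_codim (k : nat) U := (\dim U + k = M + 1)%N.
Definition is_hyperplane H := has_codim 1 H.

Definition hyp w : subspace := lker (linfun (mulmxr w^T : _ -> 'rV[R]_1)).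

Lemma mem_hyp w u : (u \in hyp w) = (u *m w^T == 0).
Proof. by rewrite memv_ker lfunE. Qed.

Definition coords w H := w != 0 /\ H = hyp w.

Definition dotv (u v : 'rV[R]_M) : R := (u *m v^T) 0 0.

Definition normal_part w : 'rV[R]_M := lsubmx w.

Definition is_normal_vector (n : 'rV[R]_M) H :=
  n != 0 /\ exists2 w, coords w H & normal_part w = n.

Definition hyp_infty : subspace := hyp (row_mx 0 1%:M).

(* U is the projective closure of a nonempty affine subspace of E^M. *)
Definition is_affine U := ~~ (U <= hyp_infty)%VS.

(* Q belongs to the pencil containing H and K. *)
Definition in_pencil H K Q := is_hyperplane Q /\ (H :&: K <= Q)%VS.

(* If w and w' are coordinates with unit normals, then w + w' and w - w' are
   coordinates of the two bisecting hyperplanes. As coordinates of this kind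
   are unique only up to sign, this predicate holds for exactly these two. *)
Definition bisects Q H K :=
  exists w w', [/\ coords w H, coords w' K,
    dotv (normal_part w) (normal_part w) = 1,
    dotv (normal_part w') (normal_part w') = 1 & coords (w + w') Q].

Definition is_dual_qlattice (x : Z2 -> subspace) :=
  (forall m, is_hyperplane (x m)) /\
  (forall m, has_codim 3
     (x m :&: x (m + e1)%R :&: x (m + e2)%R :&: x (m + e1 + e2)%R)%VS).

Definition nondegenerate_qlattice (x : Z2 -> subspace) :=
  forall m,
  [/\ ~ has_codim 2 (x m :&: x (m + e1)%R :&: x (m + e2)%R)%VS,
      ~ has_codim 2 (x m :&: x (m + e1)%R :&: x (m + e1 + e2)%R)%VS,
      ~ has_codim 2 (x m :&: x (m + e2)%R :&: x (m + e1 + e2)%R)%VS &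
      ~ has_codim 2 (x (m + e1)%R :&: x (m + e2)%R :&: x (m + e1 + e2)%R)%VS].

(* Lattice in E^M: the hyperplanes are affine, and their codimension three
   intersections are subspaces of E^M, i.e. do not lie at infinity.
   For a non-degenerate lattice the second condition says that the normals at
   m, m + e1, m + e2 are linearly independent. *)
Definition in_euclidean (x : Z2 -> subspace) :=
  (forall m, is_affine (x m)) /\
  (forall m, is_affine
     (x m :&: x (m + e1)%R :&: x (m + e2)%R :&: x (m + e1 + e2)%R)%VS).

Definition laplace (X : Z2 -> 'rV[R]_(M + 1)) (A B C : Z2 -> R) :=
  forall m, X (m + e1 + e2) =
    A (m + e1) *: X (m + e1) + B (m + e2) *: X (m + e2) + C m *: X m.

(* For a non-degenerate lattice, homogeneous coordinates X exist, determine
   A, B, C, and rescaling X by a nonvanishing function of m does not change the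
   hyperplanes [xm1 m] and [xp1 m]; so the choice of X is immaterial. *)
Definition is_dual_koenigs (x : Z2 -> subspace) :=
  is_dual_qlattice x /\
  exists (X : Z2 -> 'rV[R]_(M + 1)) (A B C : Z2 -> R),
    [/\ forall m, coords (X m) (x m),
        laplace X A B C &
        let xm1 m := hyp (X (m + e1) - B m *: X m) in
        let xp1 m := hyp (X (m + e2) - A m *: X m) in
        forall m, exists Q,
          [/\ in_pencil (xp1 m) (xm1 (m + e2 + e2)) Q,
              in_pencil (xm1 m) (xp1 (m + e1 + e1)) Q &
              in_pencil (x m) (x (m + e1 + e2)) Q]].

Definition is_dual_congruence (L : Z2 -> subspace) :=
  (forall m, has_codim 2 (L m)) /\
  (forall m e, e \in [:: e1; e2] ->
     exists H, [/\ is_hyperplane H, (L m <= H)%VS & (L (m + e)%R <= H)%VS]).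

(* Non-degeneracy is understood locally: opposite subspaces of an elementary
   quadrilateral have no common hyperplane, and neither have three consecutive
   subspaces along a coordinate line, i.e. the focal hyperplanes y_i and y_i(i)
   through L are distinct. (No common hyperplane for arbitrary subspaces that
   are not neighbours would be too strong: when x (m + e1 + e1) = x m, which
   non-degeneracy of x allows, no L conjugate to x has that property.) *)
Definition nondegenerate_congruence (L : Z2 -> subspace) :=
  forall m H, is_hyperplane H ->
  [/\ ~ ((L m <= H)%VS /\ (L (m + e1 + e2)%R <= H)%VS),
      ~ ((L (m + e1)%R <= H)%VS /\ (L (m + e2)%R <= H)%VS) &
      forall e, e \in [:: e1; e2] ->
        ~ [/\ (L (m - e)%R <= H)%VS, (L m <= H)%VS & (L (m + e)%R <= H)%VS]].

(* y is the dual focal lattice of L in the direction e (e = e1 or e2). *)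
Definition is_dual_focal (e : Z2) (L y : Z2 -> subspace) :=
  forall m,
  [/\ is_hyperplane (y m), (L m <= y m)%VS & (L (m - e)%R <= y m)%VS].

Definition conjugate (x L : Z2 -> subspace) := forall m, (L m <= x m)%VS.

(* The focal lattices are unique, as L m and L (m - e) are distinct. *)
Definition is_normal_congruence (L : Z2 -> subspace) :=
  exists y1 y2,
    [/\ is_dual_focal e1 L y1, is_dual_focal e2 L y2 &
        forall m Q,
          bisects Q (y2 m) (y2 (m + e2)) <-> bisects Q (y1 m) (y1 (m + e1))].

Definition is_dual_bianchi (x : Z2 -> subspace) :=
  is_dual_koenigs x /\
  exists L : Z2 -> subspace,
    [/\ is_dual_congruence L, nondegenerate_congruence L,
        (forall m, is_affine (L m)), is_normal_congruence L & conjugate x L].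

End Projective.

Definition Delta (R : realType) (e : Z2) (f : Z2 -> R) : Z2 -> R :=
  fun m => f (m + e) - f m.

(* Main.v *)
(* The lattice is a dual Koenigs lattice iff the invariant identity
   A C_(2) B_(12) = B C_(1) A_(12) holds, i.e. iff its homogeneous coordinates X
   can be rescaled so that X_(12) + X = F_(1) X_(1) + F_(2) X_(2).
   The hyperplanes through L form the plane span(X, h), where h is the focal
   hyperplane on the edge (m, m + e1). On an elementary quadrilateral write
   X = a + d, F_(1) X_(1) = a + b, F_(2) X_(2) = c + d, X_(12) = b + c with a, b,
   c, d along its four focal hyperplanes. Multiplying the two vectors which an
   edge receives from its two quadrilaterals gives a number for each edge.
   Normality says that the number P of the edges in direction e1 and the number
   Q of those in direction e2 do not change along these directions, and then
   P + Q = |n|^2 F; hence Delta_1 Delta_2 (|n|^2 F) = 0.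
   Conversely split |n|^2 F = P(m_2) + Q(m_1). Normalising the focal hyperplanes
   by a function psi on quadrilaterals, normality amounts to |h|^2 = P psi psi',
   where psi, psi' belong to the quadrilaterals on both sides of the edge. The
   triples (h, psi, psi') are propagated by invertible linear maps preserving
   this quadratic relation, and this propagation is flat. All non-degeneracy
   conditions say that some nonzero linear form does not vanish on (h, psi, psi'),
   so along a curve of initial values with linearly independent polynomial
   components each of them excludes finitely many parameters. *)
Require Import Defs.
From mathcomp Require Import all_boot all_order all_algebra reals.
From mathcomp Require Import ring lra.
From mathcomp Require Import boolp classical_sets cardinality ereal measure lebesgue_measure.
Import Order.TTheory GRing.Theory Num.Theory.
Local Open Scope ring_scope.
Set Implicit Arguments.
Unset Strict Implicit.
Unset Printing Implicit Defensive.

(** * Hyperplanes and their coordinates *)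

(** The cokernel of a basis matrix kills exactly its row space [U], so one of its columns is nonzero
    on [u]. *)
Lemma vspace_separation (K : fieldType) n (U : {vspace 'rV[K]_n}) u :
  u \notin U ->
  exists2 v : 'rV_n, forall x, x \in U -> x *m v^T = 0 & u *m v^T != 0.
Proof.
move=> uU; pose B := \matrix_i (vbasis U)`_i : 'M[K]_(\dim U, n).
have rB i : row i B = (vbasis U)`_i by apply/rowP=> j; rewrite !mxE.
have [j uj] : exists j, (u *m cokermx B) 0 j != 0.
  apply/existsP; apply: contraR uU; rewrite negb_exists => /forallP h.
  have : (u <= B)%MS.
    rewrite submxE; apply/eqP/rowP=> j; rewrite [RHS]mxE.
    by apply/eqP; have := h j; rewrite negbK.
  case/submxP=> D ->; rewrite mulmx_sum_row; apply: memv_suml => i _.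
  by rewrite memvZ // rB vbasis_mem // mem_nth ?size_tuple.
exists (col j (cokermx B))^T; rewrite ?trmxK.
  move=> x xU; rewrite (coord_vbasis xU) mulmx_suml big1 // => i _.
  rewrite -rB -scalemxAl colE mulmxA -row_mul mulmx_coker row0 mul0mx.
  by rewrite scaler0.
rewrite colE mulmxA -colE; apply: contraNneq uj => /rowP/(_ 0).
by rewrite !mxE => ->.
Qed.

Lemma exists_annihilator (K : fieldType) n (U : {vspace 'rV[K]_n}) :
  (\dim U < n)%N -> exists2 v : 'rV_n, v != 0 & forall x, x \in U -> x *m v^T = 0.
Proof.
move=> dU; have [u _ /vspace_separation[v vU uv]] :
    exists2 u, u \in fullv & u \notin U.
  apply/subvPn; apply: contraL dU => /dimvS; rewrite dimvf /dim /= mul1n.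
  by rewrite -leqNgt.
by exists v => //; apply: contraNneq uv => ->; rewrite trmx0 mulmx0.
Qed.

Section SmallFamilies.
Variables (K : fieldType) (vT : vectType K).
Implicit Types u v t w : vT.

Lemma span2P u v w :
  reflect (exists a b, w = a *: u + b *: v) (w \in <<[:: u; v]>>%VS).
Proof.
rewrite span_cons span_seq1; apply: (iffP memv_addP).
  by case=> ? /vlineP[a ->] [? /vlineP[b ->] ->]; exists a, b.
by case=> a [b ->]; exists (a *: u); rewrite ?memvZ ?memv_line //;
  exists (b *: v); rewrite ?memvZ ?memv_line.
Qed.

Lemma span3P u v t w :
  reflect (exists a b c, w = a *: u + b *: v + c *: t)
          (w \in <<[:: u; v; t]>>%VS).
Proof.
rewrite span_cons; apply: (iffP memv_addP).
  by case=> ? /vlineP[a ->] [? /span2P[b [c ->]] ->]; exists a, b, c; rewrite addrA.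
case=> a [b [c ->]]; exists (a *: u); rewrite ?memvZ ?memv_line //.
by exists (b *: v + c *: t); rewrite ?addrA //; apply/span2P; exists b, c.
Qed.

Lemma free2P u v :
  reflect (forall a b, a *: u + b *: v = 0 -> a = 0 /\ b = 0) (free [:: u; v]).
Proof.
apply: (iffP idP) => [|h].
  rewrite free_cons seq1_free span_seq1 => /andP[uv v0] a b e.
  have a0 : a = 0.
    apply: contraNeq uv => a0; apply/vlineP; exists (- (a^-1 * b)).
    by apply: (scalerI a0); rewrite scalerA mulrN mulVKf // scaleNr; apply/eqP; rewrite -addr_eq0 e.
  by split=> //; move/eqP: e; rewrite a0 scale0r add0r scaler_eq0 (negPf v0) orbF => /eqP.
rewrite free_cons seq1_free span_seq1; apply/andP; split.
  apply/negP=> /vlineP[k e]; have [] := h 1 (- k); last by move/eqP; rewrite oner_eq0.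
  by rewrite e scale1r scaleNr subrr.
apply/eqP=> v0; have [] := h 0 1; last by move=> _ /eqP; rewrite oner_eq0.
by rewrite v0 scaler0 scale0r addr0.
Qed.

Lemma free3P u v w :
  reflect (forall a b c, a *: u + b *: v + c *: w = 0 -> [/\ a = 0, b = 0 & c = 0])
          (free [:: u; v; w]).
Proof.
apply: (iffP idP) => [|h].
  rewrite free_cons => /andP[uvw /free2P vw] a b c e.
  have a0 : a = 0.
    apply: contraNeq uvw => a0; apply/span2P; exists (- (a^-1 * b)), (- (a^-1 * c)).
    apply: (scalerI a0); rewrite scalerDr !scalerA !mulrN !mulVKf // !scaleNr -opprD.
    by apply/eqP; rewrite -addr_eq0 addrA e.
  by move: e; rewrite a0 scale0r add0r => /vw[-> ->].
rewrite free_cons; apply/andP; split.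
  apply/negP=> /span2P[k [l e]]; have [] := h 1 (- k) (- l); last by move/eqP; rewrite oner_eq0.
  by rewrite e scale1r !scaleNr -addrA -opprD subrr.
by apply/free2P=> b c e; have [] := h 0 b c; rewrite ?scale0r ?add0r.
Qed.

End SmallFamilies.

Section Hyperplanes.
Variables (R : realType) (M : nat).
Local Notation V := 'rV[R]_(M + 1).
Implicit Types (u v w : V) (s : seq V) (U H : {vspace V}).

(** The annihilator of [<< s >>]. It turns inclusions in hyperplanes and codimensions into
    membership in a span and its dimension. *)
Definition hyps s : {vspace V} := (\bigcap_(w <- s) hyp w)%VS.

Lemma hyps_cons w s : hyps (w :: s) = (hyp w :&: hyps s)%VS.
Proof. exact: big_cons. Qed.

Lemma hyps1 w : hyps [:: w] = hyp w.
Proof. exact: big_seq1. Qed.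

Lemma mem_hypC u w : (u \in hyp w) = (w \in hyp u).
Proof.
by rewrite !mem_hyp -(inj_eq trmx_inj) trmx0 trmx_mul trmxK.
Qed.

Lemma mem_hyps s u : (u \in hyps s) = (<< s >> <= hyp u)%VS.
Proof.
elim: s => [|w s IHs]; first by rewrite /hyps big_nil span_nil memvf sub0v.
by rewrite hyps_cons memv_cap IHs span_cons subv_add mem_hypC memvE.
Qed.

(** Double annihilator: a vector [u] outside the span is separated from it by some [v], which is
    then a point of [hyps s] off [hyp u]. *)
Lemma hyps_sub s u : (hyps s <= hyp u)%VS = (u \in << s >>%VS).
Proof.
apply/idP/idP => [sub|us]; last first.
  by apply/subvP => x; rewrite mem_hyps mem_hypC => /subvP/(_ _ us).
apply/negPn/negP => /vspace_separation[v vs /negP]; apply.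
rewrite -mem_hyp mem_hypC; apply: (subvP sub).
rewrite mem_hyps; apply/subvP => x /vs xv.
by rewrite mem_hyp xv.
Qed.

(** Rank and nullity of the linear form of [w] restricted to [U]: it is nonzero there, so its image
    is a line. *)
Lemma dim_cap_hyp U w : ~~ (U <= hyp w)%VS -> (\dim (hyp w :&: U)).+1 = \dim U.
Proof.
move=> nUw; set f := linfun (mulmxr w^T : V -> 'rV[R]_1).
rewrite -(limg_ker_dim f U) capvC -addn1; congr (_ + _)%N.
apply/eqP; rewrite eq_sym eqn_leq; apply/andP; split.
  by rewrite (leq_trans (dimvS (subvf _))) // dimvf /dim /= muln1.
rewrite lt0n dimv_eq0; apply: contra nUw => /eqP fU0.
apply/subvP=> x xU; rewrite memv_ker -memv0 -fU0; exact: memv_img.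
Qed.

Lemma dim_hyps s : (\dim (hyps s) + \dim << s >> = M + 1)%N.
Proof.
elim: s => [|w s IHs].
  by rewrite /hyps big_nil span_nil dimv0 addn0 dimvf /dim /= mul1n.
rewrite hyps_cons span_cons; have [ws|ws] := boolP (w \in << s >>%VS).
  rewrite (capv_idPr _) ?hyps_sub // (addv_idPr _) //.
apply: etrans IHs; rewrite -(@dim_cap_hyp (hyps s) w) ?hyps_sub // dimv_disjoint_sum.
  rewrite dim_vline; have -> : w != 0 by apply: contraNneq ws => ->; exact: mem0v.
  exact: esym (addSnnS _ _).
apply/eqP; rewrite -subv0; apply/subvP => x; rewrite memv_cap.
case/andP=> /vlineP[k ->]; have [->|k0] := eqVneq k 0; first by rewrite scale0r !mem0v.
by rewrite rpredZeq (negPf k0) (negPf ws).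
Qed.

Lemma codim_hyps s k : has_codim k (hyps s) <-> \dim << s >> = k.
Proof.
have e := dim_hyps s; rewrite /has_codim; split=> [|<- //].
by move=> h; apply: (@addnI (\dim (hyps s))); rewrite e h.
Qed.

Lemma codim_hyps_free s k : free s -> size s = k -> has_codim k (hyps s).
Proof. by move=> /eqP sF <-; apply/codim_hyps. Qed.

Lemma codim_inj k U U' : has_codim k U -> has_codim k U' -> (U <= U')%VS -> U = U'.
Proof.
move=> hU hU' sub; have /addIn e := etrans hU (esym hU').
by apply/eqP; rewrite eqEdim sub e /=.
Qed.

Lemma hyperplane_coords H : is_hyperplane H -> exists w, coords w H.
Proof.
move=> hH; have [|w w0 wH] := exists_annihilator (U := H); first by
  apply: leq_trans (eq_leq hH); rewrite (addn1 (\dim H)).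
exists w; split=> //; apply: (codim_inj hH).
  by rewrite -hyps1; apply: codim_hyps_free; rewrite ?seq1_free.
by apply/subvP => x xH; rewrite mem_hyp wH.
Qed.

Lemma coords_hyperplane w H : coords w H -> is_hyperplane H.
Proof.
by case=> w0 ->; rewrite -hyps1; apply: codim_hyps_free; rewrite ?seq1_free.
Qed.

Lemma hyp_sub2 u v w :
  (hyp u :&: hyp v <= hyp w)%VS -> exists a b, w = a *: u + b *: v.
Proof. by rewrite -(hyps1 v) -hyps_cons hyps_sub => /span2P. Qed.

Lemma sub_hyp2 u v a b : (hyp u :&: hyp v <= hyp (a *: u + b *: v))%VS.
Proof. by rewrite -(hyps1 v) -hyps_cons hyps_sub; apply/span2P; exists a, b. Qed.

Lemma hyp_eq u v : u != 0 -> hyp u = hyp v -> exists2 k, k != 0 & u = k *: v.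
Proof.
move=> u0 e; have : (hyps [:: v] <= hyp u)%VS by rewrite hyps1 e subvv.
rewrite hyps_sub span_seq1 => /vlineP[k uk]; exists k => //.
by apply: contraNneq u0 => k0; rewrite uk k0 scale0r.
Qed.

Lemma hypZ k u : k != 0 -> hyp (k *: u) = hyp u.
Proof.
move=> k0; apply/vspaceP=> x; rewrite !mem_hyp linearZ /= -scalemxAr.
by rewrite scaler_eq0 (negPf k0).
Qed.

Lemma coordsZ k u H : k != 0 -> coords u H -> coords (k *: u) H.
Proof. by move=> k0 [u0 ->]; split; rewrite ?hypZ // scaler_eq0 negb_or k0. Qed.

(** Coordinates of the hyperplane at infinity; they span the kernel of [normal_part]. *)
Definition einf : V := row_mx 0 1%:M.

Lemma hyps_affine s : is_affine (hyps s) = (einf \notin << s >>%VS).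
Proof. by rewrite /is_affine hyps_sub. Qed.

Lemma normal_part0_einf w : normal_part w = 0 -> exists r, w = r *: einf.
Proof.
move=> w0; exists (rsubmx w 0 0); rewrite -[LHS]hsubmxK -/(normal_part w) w0.
by rewrite /einf scale_row_mx scaler0; congr row_mx; apply/rowP=> i; rewrite !ord1 !mxE mulr1.
Qed.

Lemma einf_neq0 : einf != 0.
Proof.
apply/eqP=> /rowP/(_ (rshift M 0)); rewrite row_mxEr !mxE => /eqP.
by rewrite oner_eq0.
Qed.

Lemma normal_part_einf : normal_part einf = 0.
Proof. exact: row_mxKl. Qed.

Lemma normal_partD u v : normal_part (u + v) = normal_part u + normal_part v.
Proof. exact: linearD. Qed.
Lemma normal_partZ k u : normal_part (k *: u) = k *: normal_part u.
Proof. exact: linearZ. Qed.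

(** The kernel of [normal_part] is spanned by [einf], which is outside the span when the subspace is
    affine. Hence [ndot] is positive definite on such a span. *)
Lemma affine_normal_inj s w :
  is_affine (hyps s) -> w \in << s >>%VS -> normal_part w = 0 -> w = 0.
Proof.
rewrite hyps_affine => es ws /normal_part0_einf[r rE].
have [r0|r0] := eqVneq r 0; first by rewrite rE r0 scale0r.
by move: ws; rewrite rE rpredZeq (negPf r0) (negPf es).
Qed.

Definition ndot u v := dotv (normal_part u) (normal_part v).

Lemma dotvE (a b : 'rV[R]_M) : dotv a b = \sum_i a 0 i * b 0 i.
Proof. by rewrite /dotv mxE; apply: eq_bigr => i _; rewrite mxE. Qed.

Lemma dotvC (a b : 'rV[R]_M) : dotv a b = dotv b a.
Proof. by rewrite !dotvE; apply: eq_bigr => i _; rewrite mulrC. Qed.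

Lemma dotv_ge0 (a : 'rV[R]_M) : 0 <= dotv a a.
Proof. by rewrite dotvE sumr_ge0 // => i _; rewrite -expr2 sqr_ge0. Qed.

Lemma dotv_eq0 (a : 'rV[R]_M) : (dotv a a == 0) = (a == 0).
Proof.
rewrite dotvE psumr_eq0 => [|i _]; last by rewrite -expr2 sqr_ge0.
apply/allP/eqP => [h|-> i _]; last by rewrite !mxE mul0r eqxx.
apply/rowP=> i; rewrite mxE; apply/eqP.
by have := h i (mem_index_enum i); rewrite -expr2 sqrf_eq0.
Qed.

Lemma ndotC u v : ndot u v = ndot v u.
Proof. exact: dotvC. Qed.
Lemma ndotDl u v w : ndot (u + v) w = ndot u w + ndot v w.
Proof. by rewrite /ndot normal_partD /dotv mulmxDl mxE. Qed.
Lemma ndotZl k u w : ndot (k *: u) w = k * ndot u w.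
Proof. by rewrite /ndot normal_partZ /dotv -scalemxAl mxE. Qed.
Lemma ndotNl u w : ndot (- u) w = - ndot u w.
Proof. by rewrite -scaleN1r ndotZl mulN1r. Qed.
Lemma ndotDr u v w : ndot w (u + v) = ndot w u + ndot w v.
Proof. by rewrite !(ndotC w) ndotDl. Qed.
Lemma ndotZr k u w : ndot w (k *: u) = k * ndot w u.
Proof. by rewrite !(ndotC w) ndotZl. Qed.
Lemma ndotNr u w : ndot w (- u) = - ndot w u.
Proof. by rewrite !(ndotC w) ndotNl. Qed.
Definition ndotE := (ndotDl, ndotDr, ndotNl, ndotNr, ndotZl, ndotZr).

Lemma ndot_gt0 u : (0 < ndot u u) = (normal_part u != 0).
Proof. by rewrite lt_neqAle dotv_ge0 andbT eq_sym dotv_eq0. Qed.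

End Hyperplanes.

(** * Flat sections over the lattice and generic parameters *)

Lemma int_step_ind (P : int -> Prop) :
  P 0 -> (forall z, P z -> P (z + 1)) -> (forall z, P (z + 1) -> P z) ->
  forall z, P z.
Proof.
move=> P0 up dn; elim=> [//|n IHn|n IHn].
  have e : n.+1%:Z = n%:Z + 1 by rewrite -addn1 PoszD.
  by rewrite e; apply: up.
have e : - n.+1%:Z + 1 = - n%:Z by rewrite -addn1 PoszD opprD addrNK.
by apply: dn; apply: eq_ind_r IHn _ e.
Qed.

(** Iterate [S] to the right and [S'] to the left of 0; on the left the recurrence for [S] holds
    because [S z] undoes [S' z]. *)
Lemma line_section (T : Type) (I : int -> T -> Prop) (S S' : int -> T -> T) t0 :
    I 0 t0 ->
    (forall z t, I z t -> I (z + 1) (S z t)) ->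
    (forall z t, I (z + 1) t -> I z (S' z t)) ->
    (forall z t, S z (S' z t) = t) ->
  exists f : int -> T,
    [/\ f 0 = t0, forall z, f (z + 1) = S z (f z) & forall z, I z (f z)].
Proof.
move=> I0 IS IS' SK.
pose pos := fix pos n := if n is n'.+1 then S n' (pos n') else t0.
(* [neg n] is the value at [- n]; since [Negz n'] is [- n'.+1], the step to the left ends at
   position [Negz n']. *)
pose neg := fix neg n := if n is n'.+1 then S' (Negz n') (neg n') else t0.
have Negz1 n : Negz n + 1 = - n%:Z by rewrite NegzE -addn1 PoszD opprD addrK.
exists (fun z => match z with Posz n => pos n | Negz n => neg n.+1 end); split=> //.
  case=> n; first by rewrite -PoszD addn1.
  by rewrite Negz1 SK; case: n => [|n] //; rewrite -NegzE.
have Ineg n : I (- n%:Z) (neg n).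
  elim: n => [|n IHn]; first by rewrite oppr0.
  by rewrite -NegzE; apply: IS'; rewrite Negz1.
case=> n; last by rewrite NegzE; apply: Ineg.
by elim: n => [//|n IHn]; rewrite -addn1 PoszD addn1; apply: IS.
Qed.

Lemma add_e1 (a b : int) : ((a, b) : Z2) + e1 = (a + 1, b).
Proof. by congr pair; rewrite /= addr0. Qed.

Lemma add_e2 (a b : int) : ((a, b) : Z2) + e2 = (a, b + 1).
Proof. by congr pair; rewrite /= addr0. Qed.

(** The section is built along the horizontal axis by [S1], then along each vertical line by [S2].
    Flatness carries the recurrence for [S1] from row to row, downwards by injectivity of [S2]. *)
Lemma flat_section (T : Type) (I : Z2 -> T -> Prop) (S1 S1' S2 S2' : Z2 -> T -> T) t0 :
    I 0 t0 ->
    (forall m t, I m t -> I (m + e1) (S1 m t)) ->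
    (forall m t, I (m + e1) t -> I m (S1' m t)) ->
    (forall m t, I m t -> I (m + e2) (S2 m t)) ->
    (forall m t, I (m + e2) t -> I m (S2' m t)) ->
    (forall m t, S1 m (S1' m t) = t) ->
    (forall m t, S2 m (S2' m t) = t) ->
    (forall m t, S2' m (S2 m t) = t) ->
    (forall m t, S2 (m + e1) (S1 m t) = S1 (m + e2) (S2 m t)) ->
  exists s : Z2 -> T,
    [/\ forall m, I m (s m), forall m, s (m + e1) = S1 m (s m) &
        forall m, s (m + e2) = S2 m (s m)].
Proof.
move=> I0 IS1 IS1' IS2 IS2' S1K S2K S2K' flat.

have [r [r0 rS rI]] := line_section (I := fun a => I (a, 0)) (S := fun a => S1 (a, 0))
  (S' := fun a => S1' (a, 0)) I0 (fun a t h => eq_ind _ (fun k => I k _) (IS1 _ _ h) _ (add_e1 a 0))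
  (fun a t h => IS1' (a, 0) t (eq_ind_r (fun k => I k _) h (add_e1 a 0))) (fun a => S1K (a, 0)).
have /choice[g gP] a : exists g : int -> T, [/\ g 0 = r a,
    forall b, g (b + 1) = S2 (a, b) (g b) & forall b, I (a, b) (g b)].
  apply: (line_section (I := fun b => I (a, b)) (S := fun b => S2 (a, b))
    (S' := fun b => S2' (a, b)) (t0 := r a)) => // b t.
  - by move/IS2; rewrite add_e2.
  - by rewrite -add_e2 => /IS2'.
have gS1 a b : g (a + 1) b = S1 (a, b) (g a b).
  have [g0 gS _] := gP a; have [g0' gS' _] := gP (a + 1).
  have S2inj m : injective (S2 m) := can_inj (S2K' m).
  elim/int_step_ind: b => [|b IHb|b IHb]; first by rewrite g0' g0 rS.
    by rewrite gS' IHb gS -(add_e2 a b) -flat add_e1.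
  by apply: (S2inj (a + 1, b)); rewrite -gS' IHb gS -(add_e2 a b) -flat add_e1.
exists (fun m => g m.1 m.2); split=> [[a b]|[a b]|[a b]].
- by have [] := gP a.
- by rewrite add_e1 gS1.
- by rewrite add_e2; have [_ ->] := gP a.
Qed.

Lemma poly_roots_finite (R : idomainType) (q : {poly R}) :
  q != 0 -> exists s : seq R, forall t, root q t -> t \in s.
Proof.
have [n] := ubnP (size q); elim: n q => // n IHn q; rewrite ltnS => sq q0.
have [[a qa]|h] := pselect (exists a, root q a); last first.
  by exists nil => t qt; case: h; exists t.
have [p pE] := factor_theorem q a qa.
have p0 : p != 0 by apply: contraNneq q0 => p0; rewrite pE p0 mul0r.
have [|//|s sP] := IHn p.
  by apply: leq_trans sq; rewrite pE size_Mmonic ?monicXsubC // size_XsubC addn2.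
exists (a :: s) => t; rewrite pE rootM root_XsubC inE => /orP[/sP->|->//].
exact: orbT.
Qed.

(** A countable union of finite root sets cannot cover the unit interval, which has Lebesgue measure
    one. *)
Lemma exists_not_root (R : realType) (T : countType) (q : T -> {poly R}) :
  (forall i, q i != 0) -> exists t, forall i, ~~ root (q i) t.
Proof.
move=> q0; apply: contrapT => h.
have : countable (`[0, 1]%classic : set R).
  apply: (@sub_countable _ _ _ (\bigcup_(i in setT) [set t | root (q i) t]))%classic.
    apply: subset_card_le => t _; apply: contrapT => ht; apply: h; exists t => i.
    by apply/negP => ri; apply: ht; exists i.
  apply: bigcup_countable => // i _; apply: finite_set_countable.
  have [s sP] := poly_roots_finite (q0 i).
  by apply: (sub_finite_set _ (finite_seq s)) => t /sP.
move/countable_lebesgue_measure0; rewrite lebesgue_measure_itv /= lte_fin ltr01.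
by rewrite oppr0 adde0 => /eqP; rewrite eqe oner_eq0.
Qed.

(** * Koenigs lattices and the Moutard equation *)

(** Dropping [z] lowers the dimension by at most one, and the value two is excluded. *)
Lemma triple_free (K : fieldType) (vT : vectType K) (z u v w : vT) :
    \dim <<[:: z; u; v; w]>> = 3%N -> \dim <<[:: u; v; w]>> <> 2%N ->
  free [:: u; v; w] /\ z \in <<[:: u; v; w]>>%VS.
Proof.
set s := [:: u; v; w] => d4 d3.
have sub : (<< s >> <= <<z :: s>>)%VS by rewrite span_cons addvSr.
have s3 : \dim << s >> = 3%N.
  apply/eqP; rewrite eqn_leq dim_span ltn_neqAle eq_sym.
  have : (\dim <<z :: s>> <= 1 + \dim << s >>)%N.
    rewrite span_cons; apply: leq_trans (leq_of_leqif (dimv_add_leqif _ _)) _.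
    by apply: leq_add => //; rewrite dim_vline leq_b1.
  rewrite d4 add1n ltnS => ->; rewrite andbT; exact/eqP.
split; first by rewrite /free s3.
have -> : << s >>%VS = <<z :: s>>%VS by apply/eqP; rewrite eqEdim sub s3 d4.
by rewrite memv_span // mem_head.
Qed.

Section Lattice.
Variables (R : realType) (M : nat).
Local Notation V := 'rV[R]_(M + 1).
Implicit Types (x : Z2 -> {vspace V}) (X : Z2 -> V) (F : Z2 -> R).

Lemma quad_free x X :
    is_dual_qlattice x -> nondegenerate_qlattice x ->
    (forall m, coords (X m) (x m)) ->
  forall m, let X1 := X (m + e1) in let X2 := X (m + e2) in
  let X12 := X (m + e1 + e2) in
  [/\ free [:: X m; X1; X2], free [:: X m; X1; X12], free [:: X m; X2; X12],
      free [:: X1; X2; X12] & X12 \in <<[:: X m; X1; X2]>>%VS].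
Proof.
move=> [_ hx] hnd cX m X1 X2 X12.
have xE k : x k = hyp (X k) by case: (cX k).
have h3 u v w : (hyp u :&: hyp v :&: hyp w)%VS = hyps [:: u; v; w].
  by rewrite !hyps_cons /hyps big_nil capvf capvA.
have [n1 n2 n3 n4] := hnd m.
move: (hx m) n1 n2 n3 n4; rewrite !xE -/X1 -/X2 -/X12 !h3.
rewrite (_ : (_ :&: hyp X12)%VS = hyps [:: X m; X1; X2; X12]); last first.
  by rewrite -h3 !hyps_cons /hyps big_nil capvf !capvA.
rewrite !codim_hyps => d n1 n2 n3 n4.
have perm z u v w : [:: z; u; v; w] =i [:: X m; X1; X2; X12] ->
    \dim <<[:: z; u; v; w]>> = 3%N by move/eq_span ->.
have [|f1 s1] := triple_free (z := X12) _ n1.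
  by apply: perm => y; rewrite !inE; case: eqP; case: eqP; case: eqP; case: eqP.
have [|f2 _] := triple_free (z := X2) _ n2.
  by apply: perm => y; rewrite !inE; case: eqP; case: eqP; case: eqP; case: eqP.
have [|f3 _] := triple_free (z := X1) _ n3.
  by apply: perm => y; rewrite !inE; case: eqP; case: eqP; case: eqP; case: eqP.
have [|f4 _] := triple_free (z := X m) _ n4.
  by apply: perm.
by [].
Qed.

(** The three hyperplanes meet in a subspace containing the affine intersection of all four, so no
    nonzero combination of their coordinates has zero normal part. *)
Lemma quad_normals_free x X :
    is_dual_qlattice x -> nondegenerate_qlattice x -> in_euclidean x ->
    (forall m, coords (X m) (x m)) ->
  forall m, free [:: normal_part (X m); normal_part (X (m + e1));
                     normal_part (X (m + e2))].
Proof.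
move=> hx hnd [_ aff] cX m; have [f _ _ _ s] := quad_free hx hnd cX m.
have xE k : x k = hyp (X k) by case: (cX k).
apply/free3P=> a b c; rewrite -!normal_partZ -!normal_partD => e.
apply: (free3P _ _ _ f).
apply: (affine_normal_inj (s := [:: X m; X (m + e1); X (m + e2)])) => //; last first.
  by apply/span3P; exists a, b, c.
move: (aff m); rewrite !xE /is_affine; apply: contra => h; apply: subv_trans h.
by rewrite !hyps_cons /hyps big_nil capvf !capvA capvSl.
Qed.

(** The discrete Moutard equation: the Laplace equation with [A = B = F] and [C = -1]. *)
Definition moutard X F := forall m,
  X (m + e1 + e2) + X m = F (m + e1) *: X (m + e1) + F (m + e2) *: X (m + e2).

(** The coordinates [q] of the common hyperplane are expanded in each of the three pencils, and
    coefficients are compared in two independent triples of neighbouring coordinate vectors. *)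
Lemma koenigs_invariant x X (A B C : Z2 -> R) :
    is_dual_qlattice x -> nondegenerate_qlattice x ->
    (forall m, coords (X m) (x m)) -> laplace X A B C ->
    (forall m, exists Q,
      [/\ in_pencil (hyp (X (m + e2) - A m *: X m))
            (hyp (X (m + e2 + e2 + e1) - B (m + e2 + e2) *: X (m + e2 + e2))) Q,
          in_pencil (hyp (X (m + e1) - B m *: X m))
            (hyp (X (m + e1 + e1 + e2) - A (m + e1 + e1) *: X (m + e1 + e1))) Q &
          in_pencil (x m) (x (m + e1 + e2)) Q]) ->
  forall m, A m * C (m + e2) * B (m + e1 + e2) = B m * C (m + e1) * A (m + e1 + e2).
Proof.
move=> hx hnd cX lX hQ m; have [f1 f2 f3 f4 _] := quad_free hx hnd cX m.
have xE k : x k = hyp (X k) by case: (cX k).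
have [Q [[hq i1] [_ i2] [_ i3]]] := hQ m.
have [q [q0 qE]] := hyperplane_coords hq; rewrite qE !xE in i1 i2 i3.
have [a1 [b1 q1]] := hyp_sub2 i1.
have [a2 [b2 q2]] := hyp_sub2 i2.
have [a3 [b3 q3]] := hyp_sub2 i3.
(* The Laplace equation on the next quadrilateral brings the shifted generator of the pencil back to
   vertices of the quadrilateral at [m]. *)
have E1 : X (m + e2 + e2 + e1) - B (m + e2 + e2) *: X (m + e2 + e2) =
    A (m + e1 + e2) *: X (m + e1 + e2) + C (m + e2) *: X (m + e2).
  rewrite (addrAC (m + e2) e2 e1) (lX (m + e2)) (addrAC m e2 e1).
  by apply/rowP=> i; rewrite !mxE; ring.
have E2 : X (m + e1 + e1 + e2) - A (m + e1 + e1) *: X (m + e1 + e1) =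
    B (m + e1 + e2) *: X (m + e1 + e2) + C (m + e1) *: X (m + e1).
  by rewrite (lX (m + e1)); apply/rowP=> i; rewrite !mxE; ring.
rewrite E1 in q1; rewrite E2 in q2.
have [c1 c2 c3] : [/\ - (a1 * A m) - a3 = 0, a1 + b1 * C (m + e2) = 0 &
    b1 * A (m + e1 + e2) - b3 = 0].
  apply: (free3P _ _ _ f3); apply: etrans (subrr q); rewrite {1}q1 q3.
  by apply/rowP=> i; rewrite !mxE; ring.
have [d1 d2 d3] : [/\ - (a2 * B m) - a3 = 0, a2 + b2 * C (m + e1) = 0 &
    b2 * B (m + e1 + e2) - b3 = 0].
  apply: (free3P _ _ _ f2); apply: etrans (subrr q); rewrite {1}q2 q3.
  by apply/rowP=> i; rewrite !mxE; ring.
have a1E : a1 = - (b1 * C (m + e2)) by apply/eqP; rewrite -addr_eq0 c2.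
have a2E : a2 = - (b2 * C (m + e1)) by apply/eqP; rewrite -addr_eq0 d2.
have b3E : b3 = b1 * A (m + e1 + e2) by apply/esym/eqP; rewrite -subr_eq0 c3.
have b3E' : b3 = b2 * B (m + e1 + e2) by apply/esym/eqP; rewrite -subr_eq0 d3.
have a3E : a3 = b1 * C (m + e2) * A m.
  by apply/esym/eqP; rewrite -subr_eq0 -c1 a1E mulNr opprK.
have a3E' : a3 = b2 * C (m + e1) * B m.
  by apply/esym/eqP; rewrite -subr_eq0 -d1 a2E mulNr opprK.
have b1N0 : b1 != 0.
  by apply: contraNneq q0 => z; rewrite q3 a3E b3E z !mul0r !scale0r addr0.
have b2N0 : b2 != 0.
  by apply: contraNneq q0 => z; rewrite q3 a3E' b3E' z !mul0r !scale0r addr0.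
(* Computing the product [a3 * b3] with one factor from each comparison, in both ways, leaves the
   common factor [b1 * b2]. *)
apply: (mulfI b1N0); apply: (mulfI b2N0); apply: etrans (_ : a3 * b3 = _).
  by rewrite a3E b3E'; ring.
by rewrite a3E' b3E; ring.
Qed.

(** If a coefficient vanished, the Laplace equation would be a dependence between three of the four
    neighbouring vectors. For [A m] and [B m] the quadrilaterals at [m - e1] and [m - e2] are
    used. *)
Lemma laplace_neq0 x X (A B C : Z2 -> R) :
    is_dual_qlattice x -> nondegenerate_qlattice x ->
    (forall m, coords (X m) (x m)) -> laplace X A B C ->
  forall m, [/\ A m != 0, B m != 0 & C m != 0].
Proof.
move=> hx hnd cX lX m; split.
- have [_ _ f _ _] := quad_free hx hnd cX (m - e1).
  apply: contraL f => /eqP A0; apply/free3P => h; have := lX (m - e1).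
  rewrite subrK A0 scale0r add0r => e.
  have [] := h (C (m - e1)) (B (m - e1 + e2)) (- 1); last first.
    by move=> _ _ /eqP; rewrite oppr_eq0 oner_eq0.
  by rewrite subrK e; apply/rowP=> i; rewrite !mxE; ring.
- have [_ f _ _ _] := quad_free hx hnd cX (m - e2).
  apply: contraL f => /eqP B0; apply/free3P => h; have := lX (m - e2).
  rewrite subrK B0 scale0r addr0 => e.
  have [] := h (C (m - e2)) (A (m - e2 + e1)) (- 1); last first.
    by move=> _ _ /eqP; rewrite oppr_eq0 oner_eq0.
  by rewrite e; apply/rowP=> i; rewrite !mxE; ring.
have [_ _ _ f _] := quad_free hx hnd cX m.
apply: contraL f => /eqP C0; apply/free3P => h; have := lX m.
rewrite C0 scale0r addr0 => e.
have [] := h (A (m + e1)) (B (m + e2)) (- 1); last first.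
    by move=> _ _ /eqP; rewrite oppr_eq0 oner_eq0.
by rewrite e; apply/rowP=> i; rewrite !mxE; ring.
Qed.

Lemma moutard_gauge (A B C : Z2 -> R) :
    (forall m, [/\ A m != 0, B m != 0 & C m != 0]) ->
    (forall m, A m * C (m + e2) * B (m + e1 + e2) = B m * C (m + e1) * A (m + e1 + e2)) ->
  exists rho : Z2 -> R, [/\ forall m, rho m != 0,
    forall m, rho (m + e1 + e2) = - (C m * rho m) &
    forall m, A m * rho (m + e1) = B m * rho (m + e2)].
Proof.
move=> nz key.
(* The state at [m] stands for the pair [(rho m, rho (m + e1))]; the two required equations
   determine how it moves. *)
pose S1 m (t : R * R) := (t.2, - (B (m + e1) / A (m + e1) * C m * t.1)).
pose S1' m (t : R * R) := (- (A (m + e1) / B (m + e1) / C m * t.2), t.1).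
pose S2 m (t : R * R) := (A m / B m * t.2, - (C m * t.1)).
pose S2' m (t : R * R) := (- (t.2 / C m), B m / A m * t.1).
have [|||||||||s [sI sS1 sS2]] := flat_section (I := fun _ (t : R * R) => t.1 != 0 /\ t.2 != 0)
   (S1 := S1) (S1' := S1') (S2 := S2) (S2' := S2') (t0 := (1, 1)).
- by rewrite /= oner_eq0.
- move=> m t [t1 t2]; have [a b c] := nz m; have [a1 b1 c1] := nz (m + e1).
  by rewrite /= oppr_eq0 !mulf_neq0 // invr_eq0.
- move=> m t [t1 t2]; have [a b c] := nz m; have [a1 b1 c1] := nz (m + e1).
  by rewrite /= oppr_eq0 !mulf_neq0 // invr_eq0.
- move=> m t [t1 t2]; have [a b c] := nz m.
  by rewrite /= oppr_eq0 !mulf_neq0 // invr_eq0.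
- move=> m t [t1 t2]; have [a b c] := nz m.
  by rewrite /= oppr_eq0 !mulf_neq0 // invr_eq0.
- move=> m [t1 t2]; have [a b c] := nz m; have [a1 b1 c1] := nz (m + e1).
  by congr pair => /=; field; rewrite a1 b1 c.
- by move=> m [t1 t2]; have [a b c] := nz m; congr pair => /=; field; rewrite ?a ?b ?c.
- by move=> m [t1 t2]; have [a b c] := nz m; congr pair => /=; field; rewrite ?a ?b ?c.
(* Flatness: in the second component it amounts to the invariant identity [key]. *)
- move=> m [t1 t2]; have [a b c] := nz m; have [a1 b1 c1] := nz (m + e1).
  have [a2 b2 c2] := nz (m + e2); have [a12 b12 c12] := nz (m + e1 + e2).
  congr pair => /=; first by field; rewrite a1 b1.
  rewrite (addrAC m e2 e1); apply: oppr_inj; rewrite !opprK.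
  apply: (mulIf (mulf_neq0 b a12)).
  transitivity (t2 * (B m * C (m + e1) * A (m + e1 + e2))); first by ring.
  by rewrite -key; field; rewrite b a12.
exists (fun m => (s m).1); split=> m.
- by have [] := sI m.
- rewrite sS2 sS1 /S2 /S1 /=; have [a1 b1 _] := nz (m + e1).
  by field; rewrite a1 b1.
- by rewrite sS1 sS2 /S2 /S1 /=; have [_ b _] := nz m; field.
Qed.

Lemma koenigs_moutard x :
    is_dual_qlattice x -> nondegenerate_qlattice x -> is_dual_koenigs x ->
  exists X F, (forall m, coords (X m) (x m)) /\ moutard X F.
Proof.
move=> hx hnd [_ [X [A [B [C [cX lX hQ]]]]]].
have key := koenigs_invariant hx hnd cX lX hQ.
have nz := laplace_neq0 hx hnd cX lX.
have [rho [r0 r12 rAB]] := moutard_gauge nz key.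
exists (fun m => (rho m)^-1 *: X m), (fun m => A m * rho m / rho (m + e2)).
split=> m; first by apply: coordsZ; rewrite ?invr_eq0.
have [_ _ c] := nz m; have rm := r0 m; have r1 := r0 (m + e1); have r2 := r0 (m + e2).
(* After rescaling by the inverse of [rho], the second gauge equation makes both Laplace
   coefficients the same function, and the first one turns [C] into -1. *)
have e : A (m + e2) * rho (m + e2) / rho (m + e2 + e2) =
    B (m + e2) * rho (m + e2) / rho (m + e1 + e2).
  have r22 := r0 (m + e2 + e2); have r112 := r0 (m + e1 + e2); have := rAB (m + e2).
  rewrite (addrAC m e2 e1) => h; apply: (mulIf r22); apply: (mulIf r112).
  by transitivity (rho (m + e2) * (A (m + e2) * rho (m + e1 + e2))); [field|rewrite h; field].
rewrite e r12 (lX m); apply/rowP=> i; rewrite !mxE; field.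
by rewrite rm r1 r2 c.
Qed.

Lemma moutard_koenigs x X F :
    is_dual_qlattice x -> nondegenerate_qlattice x ->
    (forall m, coords (X m) (x m)) -> moutard X F -> is_dual_koenigs x.
Proof.
move=> hx hnd cX mX; split=> //; exists X, F, F, (fun=> -1).
have lX : laplace X F F (fun=> -1).
  by move=> m; rewrite -mX; apply/rowP=> i; rewrite !mxE; ring.
split=> //= m; have xE k : x k = hyp (X k) by case: (cX k).
(* The common hyperplane: [q] is the sum of the two generators in the first pencil and in the second
   one, and by definition lies in the third. *)
pose q := F (m + e1 + e2) *: X (m + e1 + e2) - F m *: X m.
have q0 : q != 0.
  have [F0 _ _] := laplace_neq0 hx hnd cX lX m.
  have [_ f _ _ _] := quad_free hx hnd cX m; apply/negP => /eqP qE.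
  have [] := free3P _ _ _ f (- F m) 0 (F (m + e1 + e2)).
    by rewrite -[RHS]qE; apply/rowP=> i; rewrite !mxE; ring.
  by move/eqP; rewrite oppr_eq0 (negPf F0).
exists (hyp q); have hq : is_hyperplane (hyp q) by apply: (@coords_hyperplane _ _ q).
have sub2 u v : q = u + v -> (hyp u :&: hyp v <= hyp q)%VS.
  by move=> ->; have := sub_hyp2 u v 1 1; rewrite !scale1r.
split; (split; first exact: hq).
- apply: sub2; rewrite (addrAC (m + e2) e2 e1) (lX (m + e2)) (addrAC m e2 e1).
  by apply/rowP=> i; rewrite !mxE; ring.
- by apply: sub2; rewrite (lX (m + e1)); apply/rowP=> i; rewrite !mxE; ring.
rewrite !xE; have -> : q = - F m *: X m + F (m + e1 + e2) *: X (m + e1 + e2).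
  by apply/rowP=> i; rewrite !mxE; ring.
exact: sub_hyp2.
Qed.
End Lattice.

(** * Normal congruences imply the splitting *)

Section Forward.
Variables (R : realType) (M : nat).
Local Notation V := 'rV[R]_(M + 1).
Implicit Types (x L : Z2 -> {vspace V}) (X : Z2 -> V) (F : Z2 -> R) (u v w n s e : V).

Lemma free_hyp u v : u != 0 -> v != 0 -> hyp u <> hyp v -> free [:: u; v].
Proof.
move=> u0 v0 uv; rewrite free_cons seq1_free v0 andbT span_seq1.
apply/negP => /vlineP[k uk]; apply: uv; rewrite uk hypZ //.
by apply: contraNneq u0 => k0; rewrite uk k0 scale0r.
Qed.

Lemma free_eq u v a b c d : free [:: u; v] ->
  a *: u + b *: v = c *: u + d *: v -> a = c /\ b = d.
Proof.
move=> f e; have [] := free2P _ _ f (a - c) (b - d).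
  rewrite !scalerBl addrACA e -opprD; exact: subrr.
by move=> /eqP + /eqP; rewrite !subr_eq0 => /eqP -> /eqP ->.
Qed.

Lemma free2_sym u v : free [:: u; v] = free [:: v; u].
Proof. by apply: perm_free; apply/permP => p /=; rewrite addnCA. Qed.

(* In the plane spanned by the unit vectors n and s, the reflection exchanging
   n and s fixes their bisector, hence it also exchanges e and w. *)
Lemma bisector_reflection n s a1 b1 a2 b2 k :
    let e := a1 *: n + b1 *: s in let w := a2 *: n + b2 *: s in
    free [:: n; s] -> ndot n n = 1 -> ndot s s = 1 -> ndot e e = 1 -> ndot w w = 1 ->
    k != 0 -> 1 + ndot n s != 0 -> e + w = k *: (n + s) ->
  a2 = b1 /\ b2 = a1.
Proof.
move=> e w f nn ss ee ww k0 g0 E.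
have [Ea Eb] : a1 + a2 = k /\ b1 + b2 = k.
  apply: (free_eq f); rewrite -scalerDr -E /e /w.
  by apply/rowP=> i; rewrite !mxE; ring.
have a2E : a2 = k - a1 by rewrite -Ea addrC addKr.
have b2E : b2 = k - b1 by rewrite -Eb addrC addKr.
have : ndot w w - ndot e e = 2 * k * (1 + ndot n s) * (k - a1 - b1).
  by rewrite /e /w a2E b2E !ndotE (ndotC s n) nn ss; ring.
rewrite ww ee subrr => /esym/eqP.
rewrite !mulf_eq0 pnatr_eq0 (negPf k0) (negPf g0) /= subr_eq0 => /eqP b1E.
by rewrite a2E b2E -b1E; split; ring.
Qed.

(** The letters stand for the east, north, west and south edges at a vertex, the digits for its four
    quadrilaterals, counted from the north-east one. All coefficients are solved for in the basis
    [n], [s], in which [e] and [w] are mirror images; the unit length of [e] eliminates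
    [ndot n s]. *)
Lemma bisector_components n s a b (X : V) (F : R) E1 N1 W2 N2 W3 S3 E4 S4 :
    let e := a *: n + b *: s in let w := b *: n + a *: s in
    free [:: n; s] -> a != 0 -> b != 0 ->
    ndot n n = 1 -> ndot s s = 1 -> ndot e e = 1 -> ndot w w = 1 ->
    X \in <<[:: n; s]>>%VS ->
    X = E1 *: e + N1 *: n -> F *: X = W2 *: w + N2 *: n ->
    X = W3 *: w + S3 *: s -> F *: X = E4 *: e + S4 *: s ->
  [/\ E1 * E4 = W2 * W3, N1 * N2 = S3 * S4 & E1 * E4 + N1 * N2 = F * ndot X X].
Proof.
move=> e w f a0 b0 nn ss ee ww /span2P[p [q XE]] h1 h2 h3 h4.
have [p1 q1] : p = E1 * a + N1 /\ q = E1 * b.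
  by apply: (free_eq f); rewrite -XE {1}h1 /e; apply/rowP=> i; rewrite !mxE; ring.
have [p2 q2] : F * p = W2 * b + N2 /\ F * q = W2 * a.
  apply: (free_eq f); rewrite -!scalerA -scalerDr -XE h2 /w.
  by apply/rowP=> i; rewrite !mxE; ring.
have [p3 q3] : p = W3 * b /\ q = W3 * a + S3.
  by apply: (free_eq f); rewrite -XE {1}h3 /w; apply/rowP=> i; rewrite !mxE; ring.
have [p4 q4] : F * p = E4 * a /\ F * q = E4 * b + S4.
  apply: (free_eq f); rewrite -!scalerA -scalerDr -XE h4 /e.
  by apply/rowP=> i; rewrite !mxE; ring.
have gE : 2 * a * b * ndot n s = 1 - a ^+ 2 - b ^+ 2.
  have : a ^+ 2 + b ^+ 2 + 2 * a * b * ndot n s = 1.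
    by rewrite -[RHS]ee /e !ndotE (ndotC s n) nn ss; ring.
  by move=> h; rewrite -[1 in RHS]h; ring.
have E1E : E1 = q / b by rewrite q1 mulfK.
have N1E : N1 = p - q / b * a by rewrite -E1E p1; ring.
have W2E : W2 = F * q / a by rewrite q2 mulfK.
have N2E : N2 = F * p - F * q / a * b by rewrite -W2E p2; ring.
have W3E : W3 = p / b by rewrite p3 mulfK.
have S3E : S3 = q - p / b * a by rewrite -W3E q3; ring.
have E4E : E4 = F * p / a by rewrite p4 mulfK.
have S4E : S4 = F * q - F * p / a * b by rewrite -E4E q4; ring.
have ab0 : 2 * a * b != 0 by rewrite !mulf_neq0 // pnatr_eq0.
split.
- by rewrite E1E E4E W2E W3E; field; rewrite a0 b0.
- by rewrite N1E N2E S3E S4E; field; rewrite a0 b0.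
rewrite XE !ndotE (ndotC s n) nn ss.
apply: (mulfI ab0); rewrite E1E E4E N1E N2E.
transitivity (F * (2 * a * b * (p ^+ 2 + q ^+ 2) + 2 * p * q * (1 - a ^+ 2 - b ^+ 2))).
  by field; rewrite a0 b0.
by rewrite -gE; ring.
Qed.

Lemma unit_multiple u : normal_part u != 0 ->
  exists2 k : R, k != 0 & ndot (k *: u) (k *: u) = 1.
Proof.
rewrite -ndot_gt0 => h; have s0 : Num.sqrt (ndot u u) != 0 by rewrite gt_eqF // sqrtr_gt0.
exists (Num.sqrt (ndot u u))^-1; first by rewrite invr_eq0.
rewrite !ndotE -{3}(sqr_sqrtr (ltW h)); field => //.
Qed.

(** Reduction to unit vectors: the products are invariant once weighted with squared lengths,
    because each edge vector enters both of its coefficients inversely. *)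
Lemma bisects_components n s e w (X : V) (F : R) E1 N1 W2 N2 W3 S3 E4 S4 :
    free [:: n; s] -> is_affine (hyps [:: n; s]) ->
    free [:: e; w] -> free [:: e; n] -> free [:: e; s] ->
    e \in <<[:: n; s]>>%VS -> w \in <<[:: n; s]>>%VS -> X \in <<[:: n; s]>>%VS ->
    (forall Q, bisects Q (hyp s) (hyp n) <-> bisects Q (hyp w) (hyp e)) ->
    X = E1 *: e + N1 *: n -> F *: X = W2 *: w + N2 *: n ->
    X = W3 *: w + S3 *: s -> F *: X = E4 *: e + S4 *: s ->
  [/\ E1 * E4 * ndot e e = W2 * W3 * ndot w w,
      N1 * N2 * ndot n n = S3 * S4 * ndot s s &
      E1 * E4 * ndot e e + N1 * N2 * ndot n n = F * ndot X X].
Proof.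
move=> fns aff few fen fes eS wS XS bis h1 h2 h3 h4.
have inj := affine_normal_inj aff.
have nz u v : free [:: u; v] -> u != 0 /\ v != 0.
  move=> f; split; last by move: f; rewrite free_cons seq1_free => /andP[].
  by move: f; rewrite free2_sym free_cons seq1_free => /andP[].
have [[n0 s0] [e0 w0]] := (nz _ _ fns, nz _ _ few).
have nS : n \in <<[:: n; s]>>%VS by rewrite memv_span ?inE ?eqxx.
have sS : s \in <<[:: n; s]>>%VS by rewrite memv_span ?inE ?eqxx ?orbT.
have normal0 u : u \in <<[:: n; s]>>%VS -> u != 0 -> normal_part u != 0.
  by move=> uS; apply: contraNneq => /(inj _ uS) ->.
have [ke ke0 eU] := unit_multiple (normal0 _ eS e0).
have [kw kw0 wU] := unit_multiple (normal0 _ wS w0).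
have ewS : ke *: e + kw *: w \in <<[:: n; s]>>%VS by rewrite memvD ?memvZ.
have ew0 : ke *: e + kw *: w != 0.
  by apply/eqP => /(free2P _ _ few)[/eqP]; rewrite (negPf ke0).
have hypC (u : V) : u != 0 -> coords u (hyp u) by [].
(* One bisector suffices: that of the unit multiples of [e] and [w] is also the bisector of some
   unit multiples [n'] and [s']. *)
have /bis[s' [n' [cs cn sU nU [_ Q]]]] :
    bisects (hyp (ke *: e + kw *: w)) (hyp w) (hyp e).
  exists (kw *: w), (ke *: e); split=> //; try by apply: coordsZ => //; apply: hypC.
  by rewrite addrC; apply: hypC.
rewrite -!/(ndot _ _) in sU nU.
have [k k0 ewE] := hyp_eq ew0 Q.
have [kn kn0 n'E] : exists2 kn : R, kn != 0 & n' = kn *: n.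
  by case: cn => n'0 /esym; apply: hyp_eq.
have [ks ks0 s'E] : exists2 ks : R, ks != 0 & s' = ks *: s.
  by case: cs => s'0 /esym; apply: hyp_eq.
have f' : free [:: n'; s'].
  apply/free2P => a b; rewrite n'E s'E !scalerA => /(free2P _ _ fns)[/eqP + /eqP].
  by rewrite !mulf_eq0 (negPf kn0) (negPf ks0) !orbF => /eqP -> /eqP ->.
have span' u : u \in <<[:: n; s]>>%VS -> u \in <<[:: n'; s']>>%VS.
  case/span2P=> a [b ->]; apply/span2P; exists (a / kn), (b / ks).
  by rewrite n'E s'E !scalerA !divfK.
have [a1 [b1 eE]] := span2P _ _ _ (span' _ (memvZ ke eS)).
have [a2 [b2 wE]] := span2P _ _ _ (span' _ (memvZ kw wS)).
have g0 : 1 + ndot n' s' != 0.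
  have : 0 < ndot (n' + s') (n' + s').
    rewrite ndot_gt0 normal0 //; first by rewrite n'E s'E memvD ?memvZ.
    by apply: contraNneq ew0 => h; rewrite ewE addrC h scaler0.
  rewrite !ndotE nU sU (ndotC s' n') => h; rewrite gt_eqF //; lra.
have [a2E b2E] : a2 = b1 /\ b2 = a1.
  apply: (bisector_reflection (k := k) f') => //; rewrite -?eE -?wE //.
  by rewrite ewE [s' + n']addrC.
rewrite {}a2E {}b2E in wE.
(* The coefficients are nonzero because [e] is parallel neither to [n] nor to [s]. *)
have b10 : b1 != 0.
  apply/eqP => b0; have [] := free2P _ _ fen ke (- (a1 * kn)); last
    by move/eqP; rewrite (negPf ke0).
  by rewrite eE b0 n'E; apply/rowP=> i; rewrite !mxE; ring.
have a10 : a1 != 0.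
  apply/eqP => a0; have [] := free2P _ _ fes ke (- (b1 * ks)); last
    by move/eqP; rewrite (negPf ke0).
  by rewrite eE a0 s'E; apply/rowP=> i; rewrite !mxE; ring.
have resc (kx ky p q : R) (u v : V) : kx != 0 -> ky != 0 ->
    p *: u + q *: v = (p / kx) *: (kx *: u) + (q / ky) *: (ky *: v).
  by move=> hx hy; rewrite !scalerA !divfK.
rewrite (resc ke kn _ _ e n ke0 kn0) eE -n'E in h1.
rewrite (resc kw kn _ _ w n kw0 kn0) wE -n'E in h2.
rewrite (resc kw ks _ _ w s kw0 ks0) wE -s'E in h3.
rewrite (resc ke ks _ _ e s ke0 ks0) eE -s'E in h4.
rewrite eE in eU; rewrite wE in wU.
have [g1 g2 g3] := bisector_components f' a10 b10 nU sU eU wU (span' _ XS) h1 h2 h3 h4.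
have unit_sq (kx : R) u : kx != 0 -> ndot (kx *: u) (kx *: u) = 1 -> ndot u u = (kx ^+ 2)^-1.
  move=> kx0; rewrite !ndotE => h; apply: (mulfI (expf_neq0 2 kx0)).
  by rewrite divff ?expf_neq0 // -h; ring.
rewrite (unit_sq ke e) ?eE // (unit_sq kw w) ?wE // (unit_sq kn n) -?n'E // (unit_sq ks s) -?s'E //.
have sq (p q kx : R) : kx != 0 -> p * q * (kx ^+ 2)^-1 = p / kx * (q / kx).
  by move=> ?; field.
by rewrite !sq.
Qed.

(** * The edge numbers of a normal congruence *)

Section Congruence.
Variables (x L : Z2 -> {vspace V}) (X : Z2 -> V) (F : Z2 -> R).
Hypothesis cX : forall m, coords (X m) (x m).
Hypothesis mX : moutard X F.
Hypothesis congL : is_dual_congruence L.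
Hypothesis ndL : nondegenerate_congruence L.
Hypothesis affL : forall m, is_affine (L m).
Hypothesis conjL : conjugate x L.
Variables y1 y2 : Z2 -> {vspace V}.
Hypothesis foc1 : is_dual_focal e1 L y1.
Hypothesis foc2 : is_dual_focal e2 L y2.
Hypothesis bis : forall m Q, bisects Q (y2 m) (y2 (m + e2)) <-> bisects Q (y1 m) (y1 (m + e1)).
Variables eta1 eta2 : Z2 -> V.
Hypothesis c1 : forall m, coords (eta1 m) (y1 m).
Hypothesis c2 : forall m, coords (eta2 m) (y2 m).

Let y1E m : y1 m = hyp (eta1 m). Proof. by case: (c1 m). Qed.
Let y2E m : y2 m = hyp (eta2 m). Proof. by case: (c2 m). Qed.
Let eta1_neq0 m : eta1 m != 0. Proof. by case: (c1 m). Qed.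
Let eta2_neq0 m : eta2 m != 0. Proof. by case: (c2 m). Qed.

Let y1_hyp m : is_hyperplane (y1 m). Proof. by case: (foc1 m). Qed.
Let y2_hyp m : is_hyperplane (y2 m). Proof. by case: (foc2 m). Qed.
Let L_y1 m : (L m <= y1 m)%VS. Proof. by case: (foc1 m). Qed.
Let L_y2 m : (L m <= y2 m)%VS. Proof. by case: (foc2 m). Qed.
Let L_y1p m : (L m <= y1 (m + e1)%R)%VS.
Proof. by have [_ _] := foc1 (m + e1); rewrite addrK. Qed.
Let L_y2p m : (L m <= y2 (m + e2)%R)%VS.
Proof. by have [_ _] := foc2 (m + e2); rewrite addrK. Qed.

Let opposite1 m H : is_hyperplane H -> (L m <= H)%VS -> (L (m + e1 + e2)%R <= H)%VS -> False.
Proof. by move=> hH a b; have [] := ndL m hH; case. Qed.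
Let opposite2 m H : is_hyperplane H -> (L (m + e1)%R <= H)%VS -> (L (m + e2)%R <= H)%VS -> False.
Proof. by move=> hH a b; have [_] := ndL m hH; case. Qed.

Let Lm1 m : (L (m - e1)%R <= y1 m)%VS. Proof. by case: (foc1 m). Qed.
Let Lm2 m : (L (m - e2)%R <= y2 m)%VS. Proof. by case: (foc2 m). Qed.

(** Here e, w, n, s denote the focal hyperplanes on the four edges at [m]. They are pairwise
    distinct: those on one line by the condition on three consecutive subspaces, the others by the
    condition on opposite corners of a quadrilateral. *)
Let free_ew m : free [:: eta1 (m + e1); eta1 m].
Proof.
apply: free_hyp => //; rewrite -!y1E => h; have [_ _ h3] := ndL m (y1_hyp m).
by apply: (h3 e1); rewrite ?inE ?eqxx //; split=> //; rewrite -h.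
Qed.

Let free_ns m : free [:: eta2 (m + e2); eta2 m].
Proof.
apply: free_hyp => //; rewrite -!y2E => h; have [_ _ h3] := ndL m (y2_hyp m).
by apply: (h3 e2); rewrite ?inE ?eqxx ?orbT //; split=> //; rewrite -h.
Qed.

Let free_en m : free [:: eta1 (m + e1); eta2 (m + e2)].
Proof.
apply: free_hyp => //; rewrite -y1E -y2E => h.
by apply: (opposite2 (m := m) (y1_hyp (m + e1))) => //; rewrite h.
Qed.

Let free_es m : free [:: eta1 (m + e1); eta2 m].
Proof.
apply: free_hyp => //; rewrite -y1E -y2E => h.
apply: (opposite1 (m := m - e2) (y1_hyp (m + e1))) => //; first by rewrite h.
by rewrite addrAC subrK.
Qed.

Let free_wn m : free [:: eta1 m; eta2 (m + e2)].
Proof.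
apply: free_hyp => //; rewrite -y1E -y2E => h.
apply: (opposite1 (m := m - e1) (y1_hyp m)) => //.
by rewrite subrK h.
Qed.

Let free_ws m : free [:: eta1 m; eta2 m].
Proof.
apply: free_hyp => //; rewrite -y1E -y2E => h.
apply: (opposite2 (m := m - e1 - e2) (y1_hyp m)); last by rewrite subrK.
by rewrite addrAC subrK h.
Qed.

Let L_hyps m u v : free [:: u; v] -> (L m <= hyp u)%VS -> (L m <= hyp v)%VS ->
  L m = hyps [:: u; v].
Proof.
move=> f Lu Lv; apply: (codim_inj (k := 2)); first by case: congL.
  exact: codim_hyps_free.
by rewrite hyps_cons hyps1 subv_cap Lu.
Qed.

Let mem_L m u v w : free [:: u; v] -> (L m <= hyp u)%VS -> (L m <= hyp v)%VS ->
  (L m <= hyp w)%VS -> w \in <<[:: u; v]>>%VS.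
Proof. by move=> f Lu Lv Lw; rewrite -hyps_sub -(L_hyps f Lu Lv). Qed.

Let L_X m : (L m <= hyp (X m))%VS.
Proof. by case: (cX m) => _ <-. Qed.
Let L_e m : (L m <= hyp (eta1 (m + e1)%R))%VS. Proof. by rewrite -y1E. Qed.
Let L_w m : (L m <= hyp (eta1 m))%VS. Proof. by rewrite -y1E. Qed.
Let L_n m : (L m <= hyp (eta2 (m + e2)%R))%VS. Proof. by rewrite -y2E. Qed.
Let L_s m : (L m <= hyp (eta2 m))%VS. Proof. by rewrite -y2E. Qed.

(** The coefficients belong to the bottom, right, top and left edges of the quadrilateral. Each
    vector decomposes in the pencil of its vertex, and the Moutard equation makes the coefficients
    at the two ends of an edge agree. *)
Let quad_decomposition m : exists k : R * R * R * R,
  let '(ka, kb, kc, kd) := k in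
  [/\ X m = ka *: eta1 (m + e1) + kd *: eta2 (m + e2),
      F (m + e1) *: X (m + e1) = ka *: eta1 (m + e1) + kb *: eta2 (m + e1 + e2),
      X (m + e1 + e2) = kb *: eta2 (m + e1 + e2) + kc *: eta1 (m + e1 + e2) &
      F (m + e2) *: X (m + e2) = kc *: eta1 (m + e1 + e2) + kd *: eta2 (m + e2)].
Proof.
have [k1 [k2 h1]] := span2P _ _ _ (mem_L (free_en m) (L_e m) (L_n m) (L_X m)).
have [k3 [k4 h2]] := span2P _ _ _
  (memvZ (F (m + e1)) (mem_L (free_wn _) (L_w (m + e1)) (L_n _) (L_X _))).
have [k6 [k5 h3]] := span2P _ _ _ (mem_L (free_ws _) (L_w (m + e1 + e2)) (L_s _) (L_X _)).
have [k7 [k8 h4]] := span2P _ _ _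
  (memvZ (F (m + e2)) (mem_L (free_es _) (L_e (m + e2)) (L_s _) (L_X _))).
rewrite (addrAC m e2 e1) in h4.
have E : (k1 - k3) *: eta1 (m + e1) + (k2 - k8) *: eta2 (m + e2) =
    (k7 - k6) *: eta1 (m + e1 + e2) + (k4 - k5) *: eta2 (m + e1 + e2).
  apply/eqP; rewrite -subr_eq0; apply/eqP.
  transitivity (X (m + e1 + e2) + X m - (F (m + e1) *: X (m + e1) + F (m + e2) *: X (m + e2))).
    by rewrite h1 h2 h3 h4; apply/rowP=> i; rewrite !mxE; ring.
  by rewrite mX subrr.
(* [u] lies in the pencils of both [L m] and [L (m + e1 + e2)]; if it were nonzero, these opposite
   subspaces would have a common hyperplane. *)
set u := LHS in E.
have u0 : u = 0.
  apply/eqP/negPn/negP => u0; apply: (opposite1 (m := m) (H := hyp u)).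
  - exact: (coords_hyperplane (w := u)).
  - apply: subv_trans (sub_hyp2 _ _ _ _); by rewrite subv_cap L_e L_n.
  - rewrite E; apply: subv_trans (sub_hyp2 _ _ _ _); by rewrite subv_cap L_w L_s.
have [/eqP + /eqP] := free2P _ _ (free_en m) _ _ u0; rewrite !subr_eq0 => /eqP k13 /eqP k28.
rewrite u0 in E.
have [/eqP + /eqP] := free2P _ _ (free_ws (m + e1 + e2)) _ _ (esym E).
rewrite !subr_eq0 => /eqP k76 /eqP k45.
exists (k1, k4, k7, k2); split=> //; first by rewrite k13.
  by rewrite h3 k76 -k45 addrC.
by rewrite h4 k28.
Qed.

Lemma normal_congruence_delta m :
  Delta e1 (Delta e2 (fun k => ndot (X k) (X k) * F k)) m = 0.
Proof.
have [k kP] := choice quad_decomposition.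
pose ka m := (k m).1.1.1; pose kb m := (k m).1.1.2; pose kc m := (k m).1.2; pose kd m := (k m).2.
have {kP} kP m' : [/\ X m' = ka m' *: eta1 (m' + e1) + kd m' *: eta2 (m' + e2),
      F (m' + e1) *: X (m' + e1) = ka m' *: eta1 (m' + e1) + kb m' *: eta2 (m' + e1 + e2),
      X (m' + e1 + e2) = kb m' *: eta2 (m' + e1 + e2) + kc m' *: eta1 (m' + e1 + e2) &
      F (m' + e2) *: X (m' + e2) = kc m' *: eta1 (m' + e1 + e2) + kd m' *: eta2 (m' + e2)].
  by have := kP m'; rewrite /ka /kb /kc /kd; case: (k m') => [[[? ?] ?] ?].
(* The edge from [m] to [m + e1] is the bottom of the quadrilateral at [m] and the top of the one at
   [m - e2]; likewise [Q] multiplies the left and right coefficients of a vertical edge. *)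
pose P m := ka m * kc (m - e2) * ndot (eta1 (m + e1)) (eta1 (m + e1)).
pose Q m := kd m * kb (m - e1) * ndot (eta2 (m + e2)) (eta2 (m + e2)).
have PQ j : [/\ P j = P (j - e1), Q j = Q (j - e2) & P j + Q j = F j * ndot (X j) (X j)].
  have [h1 _ _ _] := kP j.
  have [_ h2 _ _] := kP (j - e1); rewrite subrK in h2.
  have i3 : j - e1 - e2 + e1 + e2 = j by rewrite (addrAC (j - e1)) !subrK.
  have [_ _ h3 _] := kP (j - e1 - e2); rewrite i3 addrC in h3.
  have [_ _ _ h4] := kP (j - e2); rewrite (addrAC j (- e2) e1) !subrK in h4.
  have LE : L j = hyps [:: eta2 (j + e2); eta2 j] by apply: L_hyps.
  have memL u : (L j <= hyp u)%VS -> u \in <<[:: eta2 (j + e2)%R; eta2 j]>>%VS by apply: mem_L.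
  have aff : is_affine (hyps [:: eta2 (j + e2); eta2 j]) by rewrite -LE.
  have bis' H : bisects H (hyp (eta2 j)) (hyp (eta2 (j + e2))) <->
      bisects H (hyp (eta1 j)) (hyp (eta1 (j + e1))) by rewrite -!y1E -!y2E; apply: bis.
  have [g1 g2 g3] := bisects_components (free_ns j) aff (free_ew j) (free_en j) (free_es j)
    (memL _ (L_e j)) (memL _ (L_w j)) (memL _ (L_X j)) bis' h1 h2 h3 h4.
  rewrite /P /Q !subrK; split.
  - exact: g1.
  - by rewrite (addrAC j (- e2)) g2; congr (_ * _); rewrite mulrC.
  - exact: g3.
have PS j : P (j + e1) = P j by have [-> _ _] := PQ (j + e1); rewrite addrK.
have QS j : Q (j + e2) = Q j by have [_ -> _] := PQ (j + e2); rewrite addrK.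
have fE j : ndot (X j) (X j) * F j = P j + Q j by have [_ _ ->] := PQ j; rewrite mulrC.
rewrite /Delta !fE !QS (addrAC m e1 e2) !PS; ring.
Qed.
End Congruence.

Lemma bianchi_delta x X F : (forall m, coords (X m) (x m)) -> moutard X F ->
    is_dual_bianchi x ->
  forall m, Delta e1 (Delta e2 (fun k => ndot (X k) (X k) * F k)) m = 0.
Proof.
move=> cX mX [_ [L [congL ndL affL [y1 [y2 [foc1 foc2 bis]]] conjL]]].
have [eta1 c1] : exists eta, forall m, coords (eta m) (y1 m).
  have h m : exists w, coords w (y1 m) by case: (foc1 m) => /hyperplane_coords.
  by have [eta etaP] := choice h; exists eta.
have [eta2 c2] : exists eta, forall m, coords (eta m) (y2 m).
  have h m : exists w, coords w (y2 m) by case: (foc2 m) => /hyperplane_coords.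
  by have [eta etaP] := choice h; exists eta.
exact: (normal_congruence_delta cX mX congL ndL affL conjL foc1 foc2 bis c1 c2).
Qed.
End Forward.

(** * From edge vectors to a normal congruence *)

Section Bisectors.
Variables (R : realType) (M : nat).
Local Notation V := 'rV[R]_(M + 1).
Implicit Types (u v w z : V).

(** Equal angles with both hyperplanes, up to sign, stated as a quadratic condition on [z] in which
    neither [u] nor [v] has to be normalised. *)
Lemma bisectsP u v H : free [:: u; v] -> is_affine (hyps [:: u; v]) ->
  bisects H (hyp u) (hyp v) <->
  exists z, [/\ z != 0, z \in <<[:: u; v]>>%VS, H = hyp z &
    ndot z u ^+ 2 * ndot v v = ndot z v ^+ 2 * ndot u u].
Proof.
move=> f aff; have inj := affine_normal_inj aff.
have uS : u \in <<[:: u; v]>>%VS by rewrite memv_span ?inE ?eqxx.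
have vS : v \in <<[:: u; v]>>%VS by rewrite memv_span ?inE ?eqxx ?orbT.
split.
  case=> u' [v' [[u'0 /esym hu] [v'0 /esym hv] uu vv [uv0 ->]]].
  rewrite -!/(ndot _ _) in uu vv.
  have [k k0 uE] := hyp_eq u'0 hu; have [l l0 vE] := hyp_eq v'0 hv.
  exists (u' + v'); split=> //; first by rewrite uE vE memvD ?memvZ.
  move: uu vv; rewrite uE vE !ndotE (ndotC v u) => uu vv.
  set U := ndot u u in uu *; set W := ndot v v in vv *; set G := ndot u v.
  transitivity ((k * (k * U)) * (U * W) + 2 * k * l * U * G * W + (l * (l * W)) * G ^+ 2).
    by ring.
  transitivity ((l * (l * W)) * (U * W) + 2 * k * l * U * G * W + (k * (k * U)) * G ^+ 2).
    by rewrite uu vv.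
  by ring.
case=> z [z0 zS -> zE].
have unit w : w \in <<[:: u; v]>>%VS -> w != 0 ->
    exists2 k : R, k != 0 & ndot (k *: w) (k *: w) = 1.
  by move=> wS w0; apply: unit_multiple; apply: contraNneq w0 => /(inj _ wS) ->.
have u0 : u != 0 by move: f; rewrite free2_sym free_cons seq1_free => /andP[].
have v0 : v != 0 by move: f; rewrite free_cons seq1_free => /andP[].
have [k k0 kE] := unit _ uS u0; have [l l0 lE] := unit _ vS v0.
have [a [b zab]] : exists a b, z = a *: (k *: u) + b *: (l *: v).
  have [a [b ->]] := span2P _ _ _ zS; exists (a / k), (b / l).
  by rewrite !scalerA !divfK.
move: (erefl (k *: u)) (erefl (l *: v)) kE lE zab.
move: {1 3 4 5}(k *: u) {1 3 4 5}(l *: v) => u' v' u'E v'E kE lE zab.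
have comb0 (p q : R) : q != 0 -> p *: u' + q *: v' != 0.
  move=> q0; apply: contraNneq q0; rewrite u'E v'E !scalerA => /(free2P _ _ f)[_ /eqP].
  by rewrite mulf_eq0 (negPf l0) orbF.
have pos (p q : R) : q != 0 -> 0 < ndot (p *: u' + q *: v') (p *: u' + q *: v').
  move=> q0; rewrite ndot_gt0; apply: contraNneq (comb0 p q q0) => /inj -> //.
  by rewrite u'E v'E memvD ?memvZ.
have gp := pos 1 1 (oner_neq0 _).
have gm : 0 < ndot (1 *: u' + (-1) *: v') (1 *: u' + (-1) *: v').
  by apply: pos; rewrite oppr_eq0 oner_neq0.
move: gp gm; rewrite !ndotE (ndotC v' u') kE lE; set g := ndot u' v' => gp gm.
have zE' : (a + b * g) ^+ 2 = (a * g + b) ^+ 2.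
  transitivity (ndot z u' ^+ 2); first by rewrite zab !ndotE kE (ndotC v' u') -/g mulr1.
  transitivity (ndot z v' ^+ 2); last by rewrite zab !ndotE lE -/g mulr1.
  transitivity ((ndot z u ^+ 2 * ndot v v) * (k ^+ 2 * l ^+ 2)).
    by rewrite -[LHS]mulr1 -lE u'E v'E !ndotE; ring.
  by rewrite zE -[RHS]mulr1 -kE u'E v'E !ndotE; ring.
(* Independence of the unit normals makes [1 + g] and [1 - g] positive, so [a = b] or [a = - b]: the
   two bisectors. *)
have : (a - b) * (a + b) * ((1 + g) * (1 - g)) = 0.
  by transitivity ((a + b * g) ^+ 2 - (a * g + b) ^+ 2); [ring|rewrite zE' subrr].
have g1 : (1 + g) * (1 - g) != 0 by rewrite mulf_neq0 // gt_eqF //; lra.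
have coordsU : coords u' (hyp u) by rewrite u'E; apply: coordsZ.
have coordsV : coords v' (hyp v) by rewrite v'E; apply: coordsZ.
move/eqP; rewrite mulf_eq0 (negPf g1) orbF mulf_eq0 subr_eq0 addr_eq0 => /orP[]/eqP ab.
  have b0 : b != 0 by apply: contraNneq z0 => b0; rewrite zab ab b0 !scale0r addr0.
  exists u', v'; split=> //; rewrite zab ab -scalerDr hypZ //; split=> //.
  by have := comb0 1 1 (oner_neq0 _); rewrite !scale1r.
have bE : b = - a by rewrite ab opprK.
have a0 : a != 0.
  by apply: contraNneq z0 => a0; rewrite zab bE a0 oppr0 !scale0r addr0.
exists u', (- v'); split=> //.
  by rewrite -scaleN1r; apply: coordsZ; rewrite ?oppr_eq0 ?oner_neq0.
  by rewrite -/(ndot _ _) !ndotE opprK.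
rewrite zab bE scaleNr -scalerBr hypZ //; split=> //.
by have := comb0 1 (-1) _; rewrite scale1r scaleN1r; apply; rewrite oppr_eq0 oner_neq0.
Qed.
End Bisectors.

(* psi1, psi2, psi3, psi4 sit on the four quadrilaterals around a vertex, and
   psi1 x - e, e + (F psi2 - psi1) x, F psi4 x - e are the other three edges. *)
Lemma bisector_quadrics (R : comNzRingType) (e x F psi1 psi2 psi3 psi4 : R) :
    psi1 + psi3 = F * (psi2 + psi4) ->
  (F * psi2 - psi1) *
    ((psi1 * x - e) ^+ 2 * (psi3 * psi4) - (F * psi4 * x - e) ^+ 2 * (psi1 * psi2)) =
  (F * psi4 - psi1) *
    (e ^+ 2 * (psi2 * psi3) - (e + (F * psi2 - psi1) * x) ^+ 2 * (psi1 * psi4)).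
Proof.
move=> h; have -> : psi3 = F * (psi2 + psi4) - psi1 by rewrite -h addrC addKr.
by ring.
Qed.

(** * The congruence with pencils spanned by [X] and [h] *)

Section Construction.
Variables (R : realType) (M : nat).
Local Notation V := 'rV[R]_(M + 1).
Variables (x : Z2 -> {vspace V}) (X : Z2 -> V) (F : Z2 -> R).
Hypothesis cX : forall m, coords (X m) (x m).
Hypothesis mX : moutard X F.
Hypothesis F_neq0 : forall m, F m != 0.
Variables (h : Z2 -> V) (psi P Q : Z2 -> R).
(** [h m] and [v m] are the focal hyperplanes on the edges from [m] to [m + e1] and to [m + e2]: the
    two components of [X m] in the quadrilateral at [m], scaled by [psi m]. *)
Let v m := psi m *: X m - h m.
Hypothesis h_e1 : forall m,
  h (m + e1) = h m + (psi (m + e1) - psi m * F (m + e1)) *: X (m + e1).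
Hypothesis h_e2 : forall m,
  h (m + e2) = h m + (psi m * F (m + e2)) *: X (m + e2) - psi m *: X m.
Hypothesis P_e1 : forall m, P (m + e1) = P m.
Hypothesis Q_e2 : forall m, Q (m + e2) = Q m.
Hypothesis P_neq0 : forall m, P m != 0.
Hypothesis Q_neq0 : forall m, Q m != 0.
Hypothesis h_sq : forall m, ndot (h (m + e2)) (h (m + e2)) = P (m + e2) * psi (m + e2) * psi m.
Hypothesis v_sq : forall m, ndot (v (m + e1)) (v (m + e1)) = Q (m + e1) * psi (m + e1) * psi m.
Hypothesis psi_neq0 : forall m, psi m != 0.
Hypothesis psi_e1 : forall m, F (m + e1) * psi m != psi (m + e1).
Hypothesis psi_e2 : forall m, F (m + e2) * psi m != psi (m + e2).
Hypothesis free4 : forall m a b c d,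
  a *: X m + b *: X (m + e1) + c *: X (m + e2) + d *: h m = 0 ->
  [/\ a = 0, b = 0, c = 0 & d = 0].
Hypothesis freeN : forall m a b, normal_part (a *: X m + b *: h m) = 0 -> a = 0 /\ b = 0.

Let L m := hyps [:: X m; h m].

Let mL m u : reflect (exists a b, u = a *: X m + b *: h m) (L m <= hyp u)%VS.
Proof. by rewrite hyps_sub; apply: span2P. Qed.

Let Xh_free m : free [:: X m; h m].
Proof.
apply/free2P => a b e; have [|-> _ _ ->] // := free4 (m := m) (a := a) (b := 0) (c := 0) (d := b).
by rewrite !scale0r !addr0.
Qed.

Let L_h m : (L m <= hyp (h m))%VS.
Proof. by apply/mL; exists 0, 1; rewrite scale0r add0r scale1r. Qed.

Let L_h1 m : (L (m + e1)%R <= hyp (h m))%VS.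
Proof.
apply/mL; exists (psi m * F (m + e1) - psi (m + e1)), 1; rewrite h_e1.
by apply/rowP=> i; rewrite !mxE; ring.
Qed.

Let L_v m : (L m <= hyp (v m))%VS.
Proof. by apply/mL; exists (psi m), (-1); rewrite /v scaleN1r. Qed.

Let L_v2 m : (L (m + e2)%R <= hyp (v m))%VS.
Proof.
apply/mL; exists (psi m * F (m + e2)), (-1); rewrite /v h_e2.
by apply/rowP=> i; rewrite !mxE; ring.
Qed.

Let h_neq0 m : h m != 0.
Proof. by move: (Xh_free m); rewrite free_cons seq1_free => /andP[]. Qed.

Let v_neq0 m : v m != 0.
Proof.
apply/eqP => v0; have [] := free2P _ _ (Xh_free m) (psi m) (-1).
  by rewrite scaleN1r.
by move=> /eqP; rewrite (negPf (psi_neq0 m)).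
Qed.

Let hyperplane (u : V) : u != 0 -> is_hyperplane (hyp u).
Proof. by move=> u0; apply: (@coords_hyperplane _ _ u). Qed.

Let L_congruence : is_dual_congruence L.
Proof.
split=> [m|m e]; first exact: codim_hyps_free.
rewrite !inE => /orP[]/eqP->.
  by exists (hyp (h m)); split; [apply: hyperplane|apply: L_h|apply: L_h1].
by exists (hyp (v m)); split; [apply: hyperplane|apply: L_v|apply: L_v2].
Qed.

Let X12E m : X (m + e1 + e2) = F (m + e1) *: X (m + e1) + F (m + e2) *: X (m + e2) - X m.
Proof. by rewrite -mX addrK. Qed.

(** A common hyperplane is expanded from both pencils in [X m], [X (m + e1)], [X (m + e2)], [h m],
    and [free4] compares coefficients. *)
Let opposite1 m u : (L m <= hyp u)%VS -> (L (m + e1 + e2)%R <= hyp u)%VS -> u = 0.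
Proof.
move=> /mL[a [b uE]] /mL[c [d uE']].
have h12 := h_e1 (m + e2); rewrite (addrAC m e2 e1) in h12.
pose k := c + d * (psi (m + e1 + e2) - psi (m + e2) * F (m + e1 + e2) + psi m).
have uE2 : u = k *: X (m + e1 + e2) + d *: (h m - (psi m * F (m + e1)) *: X (m + e1)).
  rewrite uE' h12 h_e2 /k X12E; apply/rowP=> i; rewrite !mxE; ring.
have [|a0 b0 c0 d0] := free4 (m := m) (a := a + k)
    (b := - (k * F (m + e1)) + d * psi m * F (m + e1)) (c := - (k * F (m + e2))) (d := b - d).
  apply: etrans (subrr u); rewrite {1}uE uE2 X12E.
  by apply/rowP=> i; rewrite !mxE; ring.
have k0 : k = 0.
  by apply: (mulIf (F_neq0 (m + e2))); rewrite mul0r; apply: oppr_inj; rewrite c0 oppr0.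
have d00 : d = 0.
  apply: (mulIf (mulf_neq0 (psi_neq0 m) (F_neq0 (m + e1)))); rewrite mul0r -b0 k0; ring.
by rewrite uE2 k0 d00 !scale0r addr0.
Qed.

Let opposite2 m u : (L (m + e1)%R <= hyp u)%VS -> (L (m + e2)%R <= hyp u)%VS -> u = 0.
Proof.
move=> /mL[a [b uE]] /mL[c [d uE']].
have [|a0 b0 c0 d0] := free4 (m := m) (a := d * psi m)
    (b := a + b * (psi (m + e1) - psi m * F (m + e1)))
    (c := - (c + d * psi m * F (m + e2))) (d := b - d).
  apply: etrans (subrr u); rewrite {1}uE uE' h_e1 h_e2.
  by apply/rowP=> i; rewrite !mxE; ring.
have d00 : d = 0 by apply: (mulIf (psi_neq0 m)); rewrite mul0r.
have c00 : c = 0 by apply: oppr_inj; rewrite oppr0 -[RHS]c0 d00; ring.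
by rewrite uE' d00 c00 !scale0r addr0.
Qed.

Let consecutive1 m u : (L (m - e1)%R <= hyp u)%VS -> (L m <= hyp u)%VS ->
  (L (m + e1)%R <= hyp u)%VS -> u = 0.
Proof.
move=> /mL[a [b uE]] /mL[c [d uE']] /mL[e [f uE'']].
have [|c0 _ _ _] := free4 (m := m) (a := c)
    (b := - (e + f * (psi (m + e1) - psi m * F (m + e1)))) (c := 0) (d := d - f).
  apply: etrans (subrr u); rewrite {1}uE' uE'' h_e1.
  by apply/rowP=> i; rewrite !mxE; ring.
have hE := h_e1 (m - e1); rewrite subrK in hE.
have [|a0 d0 _ _] := free4 (m := m - e1) (a := - a)
    (b := d * (psi m - psi (m - e1) * F m)) (c := 0) (d := d - b).
  apply: etrans (subrr u); rewrite {1}uE' uE c0 hE subrK.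
  by apply/rowP=> i; rewrite !mxE; ring.
(* This factor is the [X m]-component of the change of focal hyperplane at [m], so the two focal
   hyperplanes differ. *)
have : psi m - psi (m - e1) * F m != 0.
  by rewrite subr_eq0 eq_sym mulrC; have := psi_e1 (m - e1); rewrite subrK.
move/eqP: d0; rewrite mulf_eq0 => /orP[/eqP d0 _|->] //.
by rewrite uE' c0 d0 !scale0r addr0.
Qed.

Let consecutive2 m u : (L (m - e2)%R <= hyp u)%VS -> (L m <= hyp u)%VS ->
  (L (m + e2)%R <= hyp u)%VS -> u = 0.
Proof.
move=> /mL[a [b uE]] /mL[c [d uE']] /mL[e [f uE'']].
have [|c0 _ _ d0] := free4 (m := m) (a := c + f * psi m) (b := 0)
    (c := - (e + f * psi m * F (m + e2))) (d := d - f).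
  apply: etrans (subrr u); rewrite {1}uE' uE'' h_e2.
  by apply/rowP=> i; rewrite !mxE; ring.
have fE : f = d by apply/esym/eqP; rewrite -subr_eq0 d0.
have cE : c = - (d * psi m) by apply/eqP; rewrite -addr_eq0 -fE c0.
have hE := h_e2 (m - e2); rewrite subrK in hE.
have [|_ _ g0 _] := free4 (m := m - e2) (a := - (d * psi (m - e2)) - a)
    (b := 0) (c := d * (psi (m - e2) * F m - psi m)) (d := d - b).
  apply: etrans (subrr u); rewrite {1}uE' uE cE hE subrK.
  by apply/rowP=> i; rewrite !mxE; ring.
have : psi (m - e2) * F m - psi m != 0.
  by rewrite subr_eq0 mulrC; have := psi_e2 (m - e2); rewrite subrK.
move/eqP: g0; rewrite mulf_eq0 => /orP[/eqP d00 _|->] //.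
by rewrite uE' cE d00 mul0r oppr0 !scale0r addr0.
Qed.

Let L_nondegenerate : nondegenerate_congruence L.
Proof.
move=> m H /hyperplane_coords[u [/eqP u0 ->]]; split.
- by case=> a b; apply: u0; apply: opposite1 a b.
- by case=> a b; apply: u0; apply: opposite2 a b.
move=> e; rewrite !inE => /orP[]/eqP-> [a b c]; apply: u0.
  exact: consecutive1 a b c.
exact: consecutive2 a b c.
Qed.

Let L_affine m : is_affine (L m).
Proof.
rewrite hyps_affine; apply/negP => /span2P[a [b E]].
have [|a0 b0] := freeN (m := m) (a := a) (b := b); first by rewrite -E normal_part_einf.
by have := einf_neq0 R M; rewrite E a0 b0 !scale0r addr0 eqxx.
Qed.

(** The west and south edges in terms of [X m] and [h m]. The relation for [psi] results from
    reaching [h m] from [h (m - e1 - e2)] by the two paths and comparing the coefficients of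
    [X m]. *)
Let vertex_identities m :
  [/\ h (m - e1) = h m + (F m * psi (m - e1) - psi m) *: X m,
      v (m - e2) = (F m * psi (m - e2)) *: X m - h m &
      psi m + psi (m - e1 - e2) = F m * (psi (m - e1) + psi (m - e2))].
Proof.
have E1 := h_e1 (m - e1); have E2 := h_e2 (m - e2).
have E3 := h_e1 (m - e1 - e2); have E4 := h_e2 (m - e1 - e2).
have i1 : m - e1 - e2 + e1 = m - e2 by rewrite addrAC subrK.
have M3 := mX (m - e1 - e2).
rewrite !(subrK, i1) in E1 E2 E3 E4 M3.
have X3E : X (m - e1 - e2) = F (m - e2) *: X (m - e2) + F (m - e1) *: X (m - e1) - X m.
  by rewrite -M3 [X m + _]addrC addrK.
split.
- by rewrite E1; apply/rowP=> i; rewrite !mxE; ring.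
- by rewrite /v E2; apply/rowP=> i; rewrite !mxE; ring.
apply/eqP; rewrite -subr_eq0; apply/eqP.
have [|-> //] := free4 (m := m) (b := 0) (c := 0) (d := 0)
  (a := psi m + psi (m - e1 - e2) - F m * (psi (m - e1) + psi (m - e2))).
rewrite !scale0r !addr0; apply: etrans (subrr (h m)).
rewrite {1}E1 E2 E4 X3E E3.
by apply/rowP=> i; rewrite !mxE; ring.
Qed.

Let L_normal : is_normal_congruence L.
Proof.
exists (fun m => hyp (h (m - e1))), (fun m => hyp (v (m - e2))); split=> [m|m|m H].
- split; [exact: hyperplane| |exact: L_h].
  by have := L_h1 (m - e1); rewrite subrK.
- split; [exact: hyperplane| |exact: L_v].
  by have := L_v2 (m - e2); rewrite subrK.
rewrite !addrK.
have [wE sE psi3] := vertex_identities m.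
have w_free : free [:: h (m - e1); h m].
  have c0 : F m * psi (m - e1) - psi m != 0.
    by rewrite subr_eq0; have := psi_e1 (m - e1); rewrite subrK.
  apply/free2P => a b; rewrite wE => E.
  have [|] := free2P _ _ (Xh_free m) (a * (F m * psi (m - e1) - psi m)) (a + b).
    by rewrite -[RHS]E; apply/rowP=> i; rewrite !mxE; ring.
  move=> /eqP; rewrite mulf_eq0 (negPf c0) orbF => /eqP ->; rewrite add0r => ->.
  by [].
have s_free : free [:: v (m - e2); v m].
  have c0 : F m * psi (m - e2) - psi m != 0.
    by rewrite subr_eq0; have := psi_e2 (m - e2); rewrite subrK.
  apply/free2P => a b; rewrite sE /v => E.
  have [|] := free2P _ _ (Xh_free m) (a * (F m * psi (m - e2)) + b * psi m) (- a - b).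
    by rewrite -[RHS]E; apply/rowP=> i; rewrite !mxE; ring.
  move=> Ea /eqP; rewrite subr_eq0 => /eqP ab; move/eqP: Ea; rewrite -ab mulNr -mulrBr.
  by rewrite mulf_eq0 (negPf c0) orbF => /eqP ->; rewrite oppr0.
have Lw : L m = hyps [:: h (m - e1); h m].
  apply: (codim_inj (k := 2)); try exact: codim_hyps_free.
  rewrite hyps_cons hyps1 subv_cap L_h andbT.
  by have := L_h1 (m - e1); rewrite subrK.
have Ls : L m = hyps [:: v (m - e2); v m].
  apply: (codim_inj (k := 2)); try exact: codim_hyps_free.
  rewrite hyps_cons hyps1 subv_cap L_v andbT.
  by have := L_v2 (m - e2); rewrite subrK.
have aw := L_affine m; have aS := aw; rewrite Lw in aw; rewrite Ls in aS.
have spanE z : (z \in <<[:: v (m - e2)%R; v m]>>%VS) = (z \in <<[:: h (m - e1)%R; h m]>>%VS).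
  by rewrite -!hyps_sub -Lw Ls.
have i1 : m - e1 - e2 + e1 = m - e2 by rewrite addrAC subrK.
have hh := h_sq (m - e2); have ww := h_sq (m - e1 - e2).
have vv := v_sq (m - e1); have ss := v_sq (m - e1 - e2).
rewrite !(subrK, i1) in hh ww vv ss.
have Pm : P (m - e1) = P m by have := P_e1 (m - e1); rewrite subrK.
have Qm : Q (m - e2) = Q m by have := Q_e2 (m - e2); rewrite subrK.
rewrite Pm in ww; rewrite Qm in ss.
(* The squared lengths factor through [P], [Q] and [psi], so each bisecting condition becomes the
   vanishing of a quadratic expression; by [bisector_quadrics] the two expressions are proportional
   with nonzero factors [d1], [d2]. *)
have key z : (ndot z (v (m - e2)) ^+ 2 * ndot (v m) (v m) =
              ndot z (v m) ^+ 2 * ndot (v (m - e2)) (v (m - e2))) <->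
             (ndot z (h (m - e1)) ^+ 2 * ndot (h m) (h m) =
              ndot z (h m) ^+ 2 * ndot (h (m - e1)) (h (m - e1))).
  have := bisector_quadrics (ndot z (h m)) (ndot z (X m)) psi3.
  set d1 := F m * _ - _; set d2 := F m * psi (m - e2) - _; set bv := (X in d1 * X = _).
  set bh := (X in _ = d2 * X) => E.
  have d10 : d1 != 0 by rewrite subr_eq0; have := psi_e1 (m - e1); rewrite subrK.
  have d20 : d2 != 0 by rewrite subr_eq0; have := psi_e2 (m - e2); rewrite subrK.
  have vE : ndot z (v m) = psi m * ndot z (X m) - ndot z (h m) by rewrite !ndotE.
  have sE' : ndot z (v (m - e2)) = F m * psi (m - e2) * ndot z (X m) - ndot z (h m).
    by rewrite sE !ndotE.
  have wE' : ndot z (h (m - e1)) = ndot z (h m) + d1 * ndot z (X m) by rewrite wE !ndotE.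
  have Ev : ndot z (v m) ^+ 2 * ndot (v (m - e2)) (v (m - e2)) -
      ndot z (v (m - e2)) ^+ 2 * ndot (v m) (v m) = Q m * bv.
    by rewrite vv ss vE sE' /bv; ring.
  have Eh : ndot z (h m) ^+ 2 * ndot (h (m - e1)) (h (m - e1)) -
      ndot z (h (m - e1)) ^+ 2 * ndot (h m) (h m) = P m * bh.
    by rewrite hh ww wE' /bh; ring.
  have -> : (ndot z (v (m - e2)) ^+ 2 * ndot (v m) (v m) =
             ndot z (v m) ^+ 2 * ndot (v (m - e2)) (v (m - e2))) <-> bv = 0.
    split=> [H1|b0].
      by apply: (mulfI (Q_neq0 m)); rewrite -Ev H1 subrr mulr0.
    by apply/esym/eqP; rewrite -subr_eq0 Ev b0 mulr0.
  have -> : (ndot z (h (m - e1)) ^+ 2 * ndot (h m) (h m) =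
             ndot z (h m) ^+ 2 * ndot (h (m - e1)) (h (m - e1))) <-> bh = 0.
    split=> [H1|b0].
      by apply: (mulfI (P_neq0 m)); rewrite -Eh H1 subrr mulr0.
    by apply/esym/eqP; rewrite -subr_eq0 Eh b0 mulr0.
  split=> b0; first by apply: (mulfI d20); rewrite -E b0 !mulr0.
  by apply: (mulfI d10); rewrite E b0 !mulr0.
rewrite (bisectsP _ s_free aS) (bisectsP _ w_free aw).
by split=> -[z [z0 zS -> zE]]; exists z; split=> //;
  [rewrite -spanE|apply/key|rewrite spanE|apply/key].
Qed.

Lemma congruence_bianchi : is_dual_koenigs x -> is_dual_bianchi x.
Proof.
move=> kx; split=> //; exists L; split=> // m.
have [_ ->] := cX m; apply/mL; exists 1, 0; by rewrite scale1r scale0r addr0.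
Qed.
End Construction.

(** * Propagation of edge states *)

Section EdgeStates.
Variables (R : realType) (M : nat).
Local Notation V := 'rV[R]_(M + 1).
Implicit Types (a b c w Z : V) (p q s : R).

(* The state (a, p, s) of an edge: its hyperplane coordinates a, and the values
   p and s of psi on the two adjacent quadrilaterals. A state with weight P is
   admissible if |a|^2 = P p s. [turn Z P Q] goes around a vertex with
   coordinates Z, inside the quadrilateral carrying p, to the other edge of it. *)
Definition turn Z P Q (st : V * R * R) : V * R * R :=
  let: (a, p, s) := st in
  (p *: Z - a, p, (p * ndot Z Z + P * s - 2 * ndot Z a) / Q).

(** Crosses the edge: the next turn takes place in the quadrilateral on its other side. *)
Definition flip (st : V * R * R) : V * R * R := let: (a, p, s) := st in (a, s, p).

Lemma flipK st : flip (flip st) = st.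
Proof. by case: st => [[a p] s]. Qed.

Lemma turnK Z P Q st : P != 0 -> Q != 0 -> turn Z Q P (turn Z P Q st) = st.
Proof.
case: st => [[a p] s] P0 Q0; rewrite /turn; congr (_, _, _).
  by rewrite opprB addrC subrK.
by rewrite !ndotE; field; rewrite P0 Q0.
Qed.

(** Inside a quadrilateral, an edge reaches the opposite one by either side with the same result;
    the hypothesis on the corner vectors is the Moutard equation. *)
Lemma turn_quad Za Zb Zc Zd P Q P' Q' st :
    P != 0 -> P' != 0 -> Q != 0 -> Q' != 0 -> Zc + Za = Zb + Zd ->
  turn Zc Q' P' (turn Zb P Q' st) = turn Zd Q P' (turn Za P Q st).
Proof.
case: st => [[a p] s] P0 P'0 Q0 Q'0 ZE.
have -> : Zc = Zb + Zd - Za by rewrite -ZE addrK.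
rewrite /turn; congr (_, _, _); first by apply/rowP=> i; rewrite !mxE; ring.
rewrite !ndotE (ndotC Zd Zb) (ndotC Za Zb) (ndotC Zd Za); field.
by rewrite P'0 Q0 Q'0.
Qed.

(** Closure around a vertex: passing through one quadrilateral agrees with passing through the other
    three in the opposite sense. This is where the splitting of the squared length times [F]
    enters. *)
Lemma turn_vertex Z F P Q st :
    P != 0 -> Q != 0 -> P + Q = F * ndot Z Z ->
  flip (turn (F *: Z) Q P (flip st)) =
  turn Z Q P (flip (turn (F *: Z) P Q (flip (turn Z Q P st)))).
Proof.
case: st => [[a p] s] + Q0 PQ; have -> : P = F * ndot Z Z - Q by rewrite -PQ addrK.
move=> P0; rewrite /turn /flip !ndotE.
set g := ndot Z Z in P0 *; set y := ndot Z a; congr (_, _, _).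
- by apply/rowP=> i; rewrite !mxE; field; rewrite P0 Q0.
- by field; rewrite P0 Q0.
by field; rewrite P0 Q0.
Qed.

Definition admissible P (st : V * R * R) :=
  let: (a, p, s) := st in ndot a a = P * p * s.

Lemma admissible_flip P st : admissible P st -> admissible P (flip st).
Proof. by case: st => [[a p] s] /= ->; rewrite mulrAC. Qed.

(** The last component of [turn] is chosen for this: the squared length of [p *: Z - a] is divisible
    by [p]. *)
Lemma admissible_turn Z P Q st : Q != 0 -> admissible P st -> admissible Q (turn Z P Q st).
Proof.
case: st => [[a p] s] Q0 /= h; rewrite !ndotE h (ndotC a Z); field.
by rewrite Q0.
Qed.

Definition lin c p q (st : V * R * R) :=
  (st.1.1 *m c^T) 0 0 + p * st.1.2 + q * st.2.

(** Represents the form [ndot Z] in the standard pairing of coordinate vectors. *)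
Definition dual_normal Z : V := row_mx (normal_part Z) 0.

Lemma ndot_dual Z a : ndot Z a = (a *m (dual_normal Z)^T) 0 0.
Proof.
rewrite ndotC /dual_normal tr_row_mx -[a in RHS]hsubmxK mul_row_col trmx0 mulmx0 addr0.
by [].
Qed.

Lemma lin_turn c p q Z P Q st :
  lin c p q (turn Z P Q st) =
  lin (- c - (2 * q / Q) *: dual_normal Z) ((Z *m c^T) 0 0 + p + q * ndot Z Z / Q) (q * P / Q) st.
Proof.
case: st => [[a r] s]; rewrite /lin /= (ndot_dual Z a).
have -> : ((r *: Z - a) *m c^T) 0 0 = r * (Z *m c^T) 0 0 - (a *m c^T) 0 0.
  by rewrite mulmxBl -scalemxAl !mxE.
have -> k : (a *m (- c - k *: dual_normal Z)^T) 0 0 =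
    - (a *m c^T) 0 0 - k * (a *m (dual_normal Z)^T) 0 0.
  by rewrite linearB linearN linearZ /= mulmxBr mulmxN -scalemxAr !mxE.
ring.
Qed.

(* A curve t |-> f t is generic if it meets each linear hyperplane of the space
   of states finitely often, which is witnessed by a nonzero polynomial. *)
Definition generic (f : R -> V * R * R) := forall c p q,
  [|| c != 0, p != 0 | q != 0] ->
  exists2 r : {poly R}, r != 0 & forall t, lin c p q (f t) = 0 -> root r t.

Lemma generic_flip f : generic f -> generic (flip \o f).
Proof.
move=> gf c p q cpq; have [|r r0 rP] := gf c q p; first by rewrite [X in _ || X]orbC.
exists r => // t; rewrite /= => h; apply: rP; rewrite -h.
by case: (f t) => [[a ?] ?]; rewrite /lin /=; ring.
Qed.

(** A form is pulled back by the transpose of [turn], which sends nonzero forms to nonzero forms: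
    the coefficient [q] is only scaled, and for [q = 0] first [c] and then [p] can be recovered. *)
Lemma generic_turn Z P Q f : P != 0 -> Q != 0 -> generic f -> generic (turn Z P Q \o f).
Proof.
move=> P0 Q0 gf c p q cpq.
have [|r r0 rP] := gf (- c - (2 * q / Q) *: dual_normal Z)
    ((Z *m c^T) 0 0 + p + q * ndot Z Z / Q) (q * P / Q).
  have [q0|q0] := eqVneq q 0; last by rewrite !mulf_neq0 ?invr_eq0 ?orbT.
  move: cpq; rewrite q0 eqxx !mul0r mulr0 mul0r scale0r subr0 addr0 oppr_eq0.
  by have [->|//] := eqVneq c 0; rewrite trmx0 mulmx0 mxE add0r eqxx.
by exists r => // t h; apply: rP; rewrite -lin_turn.
Qed.

(** On the curve of powers with [p = 1] and [s] fixed by admissibility, a form becomes a polynomial.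
    Its degree [2 M] exceeds [M + 1] and isolates [q]; then degree 0 gives [p], and degrees 1 to
    [M + 1] give [c]. *)
Lemma moment_curve (P : R) : (2 < M)%N -> P != 0 ->
  exists f, generic f /\ forall t, admissible P (f t).
Proof.
move=> hM P0; pose a t : V := \row_i t ^+ i.+1.
pose s t := ndot (a t) (a t) / P.
exists (fun t => (a t, 1, s t)); split=> [c p q cpq|t]; last first.
  by rewrite /= /s; field.
pose r : {poly R} := \sum_(i < M + 1) c 0 i *: 'X^(i.+1) + p%:P +
   (q / P) *: \sum_(i < M) 'X^(i.+1.*2).
exists r.
  have rE k : r`_k = \sum_(i < M + 1) c 0 i * (k == i.+1)%:R + p * (k == 0)%:R +
      q / P * \sum_(i < M) (k == i.+1.*2)%:R.
    rewrite /r !coefD coefC coefZ !coef_sum; congr (_ + _ + _ * _).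
    - by apply: eq_bigr => i _; rewrite coefZ coefXn.
    - by case: eqP => _; rewrite ?mulr1 ?mulr0.
    by apply: eq_bigr => i _; rewrite coefXn.
  apply: contraL cpq => /eqP r0; have {}rE k := etrans (esym (rE k))
    (congr1 (fun u : {poly R} => u`_k) r0).
  have q0 : q = 0.
    have M0 : (0 < M)%N by apply: ltn_trans hM.
    have := rE M.*2; rewrite coef0 big1 => [|i _]; last first.
      rewrite gtn_eqF ?mulr0 //; apply: leq_ltn_trans (ltn_ord i) _.
      by rewrite -addnn ltn_add2l (ltn_trans _ hM).
    rewrite add0r double_eq0 gtn_eqF // mulr0 add0r.
    case: M M0 => // n _; rewrite big_ord_recr /= eqxx big1 => [|i _]; last first.
      by rewrite gtn_eqF // ltn_double ltnS.
    by rewrite add0r mulr1 => /eqP; rewrite mulf_eq0 invr_eq0 (negPf P0) orbF => /eqP.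
  have {}rE k : \sum_(i < M + 1) c 0 i * (k == i.+1)%:R + p * (k == 0)%:R = 0.
    by have := rE k; rewrite q0 !mul0r addr0 coef0.
  have p0 : p = 0.
    by have := rE 0; rewrite big1 ?add0r ?mulr1 // => i _; rewrite mulr0.
  have c0 : c = 0.
    apply/rowP=> j; rewrite mxE; have := rE j.+1; rewrite mulr0 addr0.
    rewrite (bigD1 j) //= eqxx mulr1 big1 ?addr0 // => i /negPf ij.
    by rewrite eqSS [_ == _ :> nat]eq_sym -val_eqE in ij *; rewrite ij mulr0.
  by rewrite q0 p0 c0 !eqxx.
move=> t h; rewrite /root; apply/eqP; rewrite -h /lin /= /r.
rewrite !hornerD hornerC hornerZ !horner_sum mulr1.
congr (_ + _ + _).
  by rewrite mxE; apply: eq_bigr => i _; rewrite hornerZ hornerXn !mxE mulrC.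
rewrite /s /ndot dotvE -mulrA [_^-1 * _]mulrC; congr (_ * (_ / _)).
by apply: eq_bigr => i _; rewrite hornerXn !mxE /= -exprD addnn.
Qed.
End EdgeStates.

(** * Flat transport of edge states and a generic solution *)

Section Dynamics.
Variables (R : realType) (M : nat).
Local Notation V := 'rV[R]_(M + 1).
Local Notation state := (V * R * R)%type.
Hypothesis hM : (2 < M)%N.
Variables (X : Z2 -> V) (F P Q : Z2 -> R).
Hypothesis mX : moutard X F.
Hypothesis F_neq0 : forall m, F m != 0.
Hypothesis X_normals : forall m,
  free [:: normal_part (X m); normal_part (X (m + e1)); normal_part (X (m + e2))].
Hypothesis P_e1 : forall m, P (m + e1) = P m.
Hypothesis Q_e2 : forall m, Q (m + e2) = Q m.
Hypothesis P_neq0 : forall m, P m != 0.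
Hypothesis Q_neq0 : forall m, Q m != 0.
Hypothesis PQ : forall m, P m + Q m = F m * ndot (X m) (X m).

(** The state at [m] sits on the edge from [m] to [m + e1] and carries first the quadrilateral
    above. [to_right] moves it to the right edge of that quadrilateral; [step1] then crosses to the
    next bottom edge, while [step2] goes on to the top edge and crosses it. *)
Let to_right m := turn (F (m + e1) *: X (m + e1)) (P m) (Q (m + e1)).
Let step1 m (st : state) := turn (X (m + e1)) (Q (m + e1)) (P m) (flip (to_right m st)).
Let step1' m (st : state) :=
  turn (F (m + e1) *: X (m + e1)) (Q (m + e1)) (P m)
    (flip (turn (X (m + e1)) (P m) (Q (m + e1)) st)).
Let step2 m (st : state) :=
  flip (turn (X (m + e1 + e2)) (Q (m + e1)) (P (m + e2)) (to_right m st)).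
Let step2' m (st : state) :=
  turn (F (m + e1) *: X (m + e1)) (Q (m + e1)) (P m)
    (turn (X (m + e1 + e2)) (P (m + e2)) (Q (m + e1)) (flip st)).

(** In the quadrilateral at [m + e1] the route by the right edge is replaced by the left one, which
    cancels the end of [step1]. What remains is closure around [m + e1 + e2]. *)
Let step_flat m st : step2 (m + e1) (step1 m st) = step1 (m + e2) (step2 m st).
Proof.
rewrite /step2 /to_right (@turn_quad _ _ (X (m + e1)) _ _
  (F (m + e1 + e2) *: X (m + e1 + e2)) _ (Q (m + e1))) //.
rewrite /step1 P_e1 turnK //.
rewrite /to_right (addrAC m e2 e1) Q_e2.
have -> : P (m + e1 + e2) = P (m + e2) by rewrite addrAC P_e1.
rewrite turn_vertex //.
by rewrite -PQ Q_e2 addrAC P_e1.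
Qed.

Let inv m (f : R -> state) := generic f /\ forall t, admissible (P m) (f t).

(** The whole curve of initial states is transported, so one parameter [t] indexes a solution on all
    of the lattice. *)
Let generic_sections : exists s : Z2 -> R -> state,
  [/\ forall m, inv m (s m), forall m t, s (m + e1) t = step1 m (s m t) &
      forall m t, s (m + e2) t = step2 m (s m t)].
Proof.
have [f0 [gf0 af0]] := moment_curve hM (P_neq0 0).
have [|||||||||s [sI sS1 sS2]] := flat_section (I := inv) (t0 := f0)
  (S1 := fun m f => step1 m \o f) (S1' := fun m f => step1' m \o f)
  (S2 := fun m f => step2 m \o f) (S2' := fun m f => step2' m \o f).
- by [].
- move=> m f [gf af]; split=> [|t].
    rewrite (_ : _ \o f = turn (X (m + e1)) (Q (m + e1)) (P m) \o
      (@flip _ _ \o (to_right m \o f))) //.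
    by apply: generic_turn => //; apply/generic_flip/generic_turn.
  by rewrite P_e1; apply: admissible_turn => //; apply/admissible_flip/admissible_turn.
- move=> m f [gf af]; rewrite P_e1 in af; split=> [|t].
    rewrite (_ : _ \o f = turn (F (m + e1) *: X (m + e1)) (Q (m + e1)) (P m) \o
      (@flip _ _ \o (turn (X (m + e1)) (P m) (Q (m + e1)) \o f))) //.
    by apply: generic_turn => //; apply/generic_flip/generic_turn.
  by apply: admissible_turn => //; apply/admissible_flip/admissible_turn.
- move=> m f [gf af]; split=> [|t].
    rewrite (_ : _ \o f = @flip _ _ \o
      (turn (X (m + e1 + e2)) (Q (m + e1)) (P (m + e2)) \o (to_right m \o f))) //.
    by apply/generic_flip/generic_turn => //; apply: generic_turn.
  by apply: admissible_flip; apply: admissible_turn => //; apply: admissible_turn.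
- move=> m f [gf af]; split=> [|t].
    rewrite (_ : _ \o f = turn (F (m + e1) *: X (m + e1)) (Q (m + e1)) (P m) \o
      (turn (X (m + e1 + e2)) (P (m + e2)) (Q (m + e1)) \o (@flip _ _ \o f))) //.
    by apply: generic_turn => //; apply: generic_turn => //; apply: generic_flip.
  by apply: admissible_turn => //; apply: admissible_turn => //; apply: admissible_flip.
- by move=> m f; apply/funext => t /=; rewrite /step1 /step1' /to_right turnK // flipK turnK.
- by move=> m f; apply/funext => t /=; rewrite /step2 /step2' /to_right turnK // turnK // flipK.
- by move=> m f; apply/funext => t /=; rewrite /step2 /step2' /to_right flipK turnK // turnK.
- by move=> m f; apply/funext => t /=; apply: step_flat.
by exists s; split=> // m t; rewrite ?sS1 ?sS2.
Qed.

Let X_free m a b c : a *: X m + b *: X (m + e1) + c *: X (m + e2) = 0 ->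
  [/\ a = 0, b = 0 & c = 0].
Proof.
move=> e; apply: (free3P _ _ _ (X_normals m)).
by rewrite -!normal_partZ -!normal_partD e /normal_part linear0.
Qed.

Lemma congruence_data : exists (h : Z2 -> V) (psi : Z2 -> R),
  let v m := psi m *: X m - h m in
  [/\ [/\ forall m, h (m + e1) = h m + (psi (m + e1) - psi m * F (m + e1)) *: X (m + e1),
          forall m, h (m + e2) = h m + (psi m * F (m + e2)) *: X (m + e2) - psi m *: X m,
          forall m, ndot (h (m + e2)) (h (m + e2)) = P (m + e2) * psi (m + e2) * psi m &
          forall m, ndot (v (m + e1)) (v (m + e1)) = Q (m + e1) * psi (m + e1) * psi m],
      [/\ forall m, psi m != 0,
          forall m, F (m + e1) * psi m != psi (m + e1) &
          forall m, F (m + e2) * psi m != psi (m + e2)],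
      forall m a b c d,
        a *: X m + b *: X (m + e1) + c *: X (m + e2) + d *: h m = 0 ->
        [/\ a = 0, b = 0, c = 0 & d = 0] &
      forall m a b, normal_part (a *: X m + b *: h m) = 0 -> a = 0 /\ b = 0].
Proof.
have [s [sI sS1 sS2]] := generic_sections.
(* A form vanishing on the three coordinate vectors, which span less than the whole space as
   [M > 2]; if it is nonzero on [h m], the four vectors are independent. *)
have /choice[cq cqP] (m : Z2) : exists c : V, c != 0 /\
    forall u, u \in <<[:: X m; X (m + e1)%R; X (m + e2)%R]>>%VS -> u *m c^T = 0.
  have [|c c0 cP] := exists_annihilator (U := <<[:: X m; X (m + e1)%R; X (m + e2)%R]>>%VS).
    apply: leq_ltn_trans (dim_span _) _; apply: leq_ltn_trans (hM : (3 <= M)%N) _.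
    by rewrite addn1.
  by exists c.
(* Similarly, a form on normals that kills the normal of [X m] and detects that of [h m]. *)
have /choice[cn cnP] (m : Z2) : exists c : 'rV[R]_M, c != 0 /\ normal_part (X m) *m c^T = 0.
  have [|c c0 cP] := exists_annihilator (U := <[normal_part (X m)]>%VS).
    by rewrite dim_vline; apply: leq_ltn_trans (leq_b1 _) _; apply: ltn_trans hM.
  by exists c; split=> //; apply: cP; apply: memv_line.
have : forall m, exists q : {poly R}, q != 0 /\ forall t, ~~ root q t ->
    [/\ lin 0 1 0 (s m t) != 0, lin 0 (F (m + e1)) (-1) (to_right m (s m t)) != 0,
        lin 0 (-1) (F (m + e2)) (s (m + e2) t) != 0,
        lin (cq m) 0 0 (s m t) != 0 & lin (row_mx (cn m) 0) 0 0 (s m t) != 0].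
  move=> m; have [gs _] := sI m; have [gs2 _] := sI (m + e2).
  have gr : generic (to_right m \o s m) by apply: generic_turn.
  have [|r1 r10 r1P] := gs 0 1 0; first by rewrite oner_eq0 orbT.
  have [|r2 r20 r2P] := gr 0 (F (m + e1)) (-1); first by rewrite F_neq0 orbT.
  have [|r3 r30 r3P] := gs2 0 (-1) (F (m + e2)); first by rewrite F_neq0 !orbT.
  have [|r4 r40 r4P] := gs (cq m) 0 0; first by have [->] := cqP m.
  have [|r5 r50 r5P] := gs (row_mx (cn m) 0) 0 0.
    have [c0 _] := cnP m; apply/orP; left; apply: contraNneq c0 => e.
    by rewrite -[cn m](row_mxKl _ (0 : 'rV_1)) e linear0.
  exists (r1 * r2 * r3 * r4 * r5); split; first by rewrite !mulf_neq0.
  move=> t; rewrite !rootM !negb_or -!andbA => /and5P[n1 n2 n3 n4 n5].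
  split; [move: n1|move: n2|move: n3|move: n4|move: n5]; apply: contraNneq.
  - exact: r1P.
  - exact: r2P.
  - exact: r3P.
  - exact: r4P.
  - exact: r5P.
(* There are countably many vertices, so a single [t] satisfies the conditions at all of them. *)
move=> /choice[q qP]; have [t tP] := exists_not_root (fun m => (qP m).1).
have {qP tP} G m := (qP m).2 t (tP m).
(* The state at [m] is read as [(h m, psi m, psi (m - e2))]. *)
exists (fun m => (s m t).1.1), (fun m => (s m t).1.2) => v.
have right m : [/\ v (m + e1) = (to_right m (s m t)).1.1,
    (s (m + e1) t).1.2 = (to_right m (s m t)).2 &
    (s (m + e1) t).1.1 = (s (m + e1) t).1.2 *: X (m + e1) - (to_right m (s m t)).1.1].
  rewrite /v sS1 /step1; case: (to_right m (s m t)) => [[a p] r] /=.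
  by split=> //; rewrite opprB addrC subrK.
have rightE m : [/\ (to_right m (s m t)).1.1 =
      ((s m t).1.2 * F (m + e1)) *: X (m + e1) - (s m t).1.1
    & (to_right m (s m t)).1.2 = (s m t).1.2].
  by rewrite /to_right; case: (s m t) => [[a p] r] /=; rewrite scalerA.
have up m : (s (m + e2) t).1.1 = (s m t).1.2 *: X (m + e1 + e2) - (to_right m (s m t)).1.1 /\
    (s (m + e2) t).2 = (s m t).1.2.
  have [_ <-] := rightE m; rewrite sS2 /step2.
  by case: (to_right m (s m t)) => [[a p] r].
split; [split|split| |].
- move=> m; have [_ _ ->] := right m; have [-> _] := rightE m.
  by apply/rowP=> i; rewrite !mxE; ring.
- move=> m; have [-> _] := up m; have [-> _] := rightE m.
  have -> : X (m + e1 + e2) = F (m + e1) *: X (m + e1) + F (m + e2) *: X (m + e2) - X m.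
    by rewrite -mX addrK.
  by apply/rowP=> i; rewrite !mxE; ring.
- move=> m; have [_ <-] := up m; have [_ /(_ t)] := sI (m + e2).
  by case: (s (m + e2) t) => [[a p] r].
- move=> m; have [-> -> _] := right m; have [_ <-] := rightE m.
  have [_ /(_ t) /(admissible_turn (F (m + e1) *: X (m + e1)) (Q_neq0 (m + e1)))] := sI m.
  rewrite -/(to_right m _); case: (to_right m (s m t)) => [[a p] r] /= ->.
  by rewrite mulrAC.
- move=> m; have [+ _ _ _ _] := G m.
  by rewrite /lin trmx0 mulmx0 mxE add0r mul1r mul0r addr0.
- move=> m; have [_ + _ _ _] := G m; have [_ -> _] := right m; have [_ <-] := rightE m.
  by rewrite /lin trmx0 mulmx0 mxE add0r mulN1r subr_eq0.
- move=> m; have [_ _ + _ _] := G m; have [_ E] := up m.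
  by rewrite /lin trmx0 mulmx0 mxE add0r E mulN1r addrC subr_eq0.
- move=> m a b c d E; have [_ _ _ + _] := G m; have [_ cP] := cqP m.
  rewrite /lin !mul0r !addr0 => h0.
  have d0 : d = 0.
    have := congr1 (fun u : V => (u *m (cq m)^T) 0 0) E.
    rewrite mulmxDl cP ?add0r -?scalemxAl ?mul0mx; last first.
      by apply/span3P; exists a, b, c.
    by rewrite mxE [RHS]mxE => /eqP; rewrite mulf_eq0 (negPf h0) orbF => /eqP.
  by move: E; rewrite d0 scale0r addr0 => /X_free[-> -> ->].
move=> m a b E; have [_ _ _ _ +] := G m; have [_ cP] := cnP m.
rewrite /lin !mul0r !addr0 => h0.
have hE u : (u *m (row_mx (cn m) 0)^T) = normal_part u *m (cn m)^T.
  by rewrite tr_row_mx -[u in LHS]hsubmxK mul_row_col trmx0 mulmx0 addr0.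
have b0 : b = 0.
  have := congr1 (fun u : 'rV[R]_M => (u *m (cn m)^T) 0 0) E.
  rewrite normal_partD !normal_partZ mulmxDl -!scalemxAl cP scaler0 add0r mul0mx -hE.
  by rewrite mxE [RHS]mxE => /eqP; rewrite mulf_eq0 (negPf h0) orbF => /eqP.
split=> //; move: E; rewrite b0 scale0r addr0 normal_partZ => E.
have [] // := free3P _ _ _ (X_normals m) a 0 0.
by rewrite E !scale0r !addr0.
Qed.
End Dynamics.

(** * The characterization *)

Lemma delta_split (R : realType) (f : Z2 -> R) :
  (forall m, Delta e1 (Delta e2 f) m = 0) ->
  forall a b, f (a, b) = f (a, 0) + f (0, b) - f (0, 0).
Proof.
move=> df.
pose g (a b : int) := f (a, b).
have dg a b : g (a + 1) (b + 1) - g (a + 1) b - (g a (b + 1) - g a b) = 0.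
  by have := df (a, b); rewrite /Delta add_e1 !add_e2.
have d a b : g (a + 1) b - g a b = g (a + 1) 0 - g a 0.
  by elim/int_step_ind: b => // b; have := dg a b; lra.
move=> a b; rewrite -/(g a b) -/(g a 0) -/(g 0 b) -/(g 0 0).
by elim/int_step_ind: a => [|a IHa|a IHa]; [|have := d a b|have := d a b]; lra.
Qed.

Section Bianchi.
Variables (R : realType) (M : nat).
Local Notation V := 'rV[R]_(M + 1).
Variables (x : Z2 -> {vspace V}) (X : Z2 -> V) (F : Z2 -> R).
Hypothesis hM : (2 < M)%N.
Hypothesis hx : is_dual_qlattice x.
Hypothesis hx_nondeg : nondegenerate_qlattice x.
Hypothesis hx_euclid : in_euclidean x.
Hypothesis cX : forall m, coords (X m) (x m).

(** [X (m + e1 + e2)] is a combination of the three other vectors, whose coefficients are already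
    determined by the independent normals. *)
Lemma moutard_of_normals :
    (forall m, normal_part (X (m + e1 + e2)) + normal_part (X m) =
      F (m + e1) *: normal_part (X (m + e1)) + F (m + e2) *: normal_part (X (m + e2))) ->
  moutard X F.
Proof.
move=> nF m; have [_ _ _ _ /span3P[a [b [c E]]]] := quad_free hx hx_nondeg cX m.
have := nF m; rewrite E !normal_partD !normal_partZ => e.
have [] := free3P _ _ _ (quad_normals_free hx hx_nondeg hx_euclid cX m)
    (a + 1) (b - F (m + e1)) (c - F (m + e2)).
  move/eqP: e; rewrite -subr_eq0 => /eqP e; rewrite -[RHS]e.
  by apply/rowP=> i; rewrite !mxE; ring.
move=> /eqP + /eqP + /eqP; rewrite addr_eq0 !subr_eq0 => /eqP-> /eqP-> /eqP->.
by apply/rowP=> i; rewrite !mxE; ring.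
Qed.

Lemma delta_bianchi : moutard X F ->
    (forall m, Delta e1 (Delta e2 (fun k => ndot (X k) (X k) * F k)) m = 0) ->
  is_dual_bianchi x.
Proof.
move=> mX df.
have F0 m : F m != 0.
  have lX : laplace X F F (fun=> -1).
    by move=> k; rewrite -mX; apply/rowP=> i; rewrite !mxE; ring.
  by have [] := laplace_neq0 hx hx_nondeg cX lX m.
set f := (fun k => _) in df; have fE := delta_split df.
(* The splitting into [P] and [Q] is free up to a constant [c], chosen so that neither of them
   vanishes anywhere. *)
have [|c cP] := exists_not_root (q := fun m : Z2 =>
  ('X - (- f (0, m.2))%:P) * ('X - (f (m.1, 0) - f (0, 0))%:P)).
  by move=> m; rewrite mulf_neq0 ?polyXsubC_eq0.
pose P (m : Z2) := f (0, m.2) + c; pose Q (m : Z2) := f (m.1, 0) - f (0, 0) - c.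
have P0 m : P m != 0.
  have := cP m; rewrite rootM !root_XsubC negb_or => /andP[+ _].
  by rewrite /P addrC addr_eq0.
have Q0 m : Q m != 0.
  have := cP m; rewrite rootM !root_XsubC negb_or => /andP[_].
  by rewrite /Q subr_eq0 eq_sym.
have P1 m : P (m + e1) = P m by rewrite /P /= addr0.
have Q2 m : Q (m + e2) = Q m by rewrite /Q /= addr0.
have PQ m : P m + Q m = F m * ndot (X m) (X m).
  by case: m => a b; rewrite [RHS]mulrC -[RHS]/(f (a, b)) fE /P /Q /=; ring.
have [h [psi [[h1 h2 hh vv] [p0 p1 p2] f4 fN]]] :=
  congruence_data hM mX F0 (quad_normals_free hx hx_nondeg hx_euclid cX) P1 Q2 P0 Q0 PQ.
apply: (congruence_bianchi cX mX F0 h1 h2 P1 Q2 P0 Q0 hh vv p0 p1 p2 f4 fN).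
exact: moutard_koenigs cX mX.
Qed.
End Bianchi.

Theorem theorem13 (R : realType) (M : nat) (hM : (2 < M)%N)
    (x : Z2 -> {vspace 'rV[R]_(M + 1)})
    (hx : is_dual_qlattice x) (hx_nondeg : nondegenerate_qlattice x)
    (hx_euclid : in_euclidean x) :
  is_dual_bianchi x <->
  exists (n : Z2 -> 'rV[R]_M) (F : Z2 -> R),
    [/\ forall m, is_normal_vector (n m) (x m),
        forall m : Z2, n (m + e1 + e2) + n m =
          F (m + e1) *: n (m + e1) + F (m + e2) *: n (m + e2) &
        forall m, Delta e1 (Delta e2 (fun k => dotv (n k) (n k) * F k)) m = 0].
Proof.
split=> [bx|[n [F [hn nF dF]]]].
  (* The normals are those of Moutard coordinates; [bianchi_delta] holds for every such choice. *)
  have [kx _] := bx; have [X [F [cX mX]]] := koenigs_moutard hx hx_nondeg kx.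
  exists (fun m => normal_part (X m)), F; split=> m; last exact: bianchi_delta cX mX bx m.
    split; last by exists (X m).
    by apply: (free_not0 (quad_normals_free hx hx_nondeg hx_euclid cX m)); rewrite inE eqxx.
  by rewrite -normal_partD mX normal_partD !normal_partZ.
have /choice[X XP] m : exists w, coords w (x m) /\ normal_part w = n m.
  by have [_ [w cw nw]] := hn m; exists w.
have cX m : coords (X m) (x m) by have [] := XP m.
have nE m : normal_part (X m) = n m by have [] := XP m.
apply: (delta_bianchi hM hx hx_nondeg hx_euclid cX (F := F)).
  by apply: moutard_of_normals hx hx_nondeg hx_euclid cX _ => m; rewrite !nE.
by move=> m; rewrite -[RHS](dF m) /Delta /ndot !nE.
Qed.
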